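(* Let $\lambda\in\mathfrak{h}^*$ be such that $\lambda(z)\neq0$, let $\mathbf{m}_\lambda$ be the maximal ideal of $Z(\mathfrak{s})$ annihilating $\Delta(\lambda)$, and set $U_\lambda:=U/U\mathbf{m}_\lambda$. (i) If $\lambda(h)\notin\frac12+\mathbb{Z}$ or $\lambda(h)=-\frac32$, then $U_\lambda$ is a simple algebra. (ii) If $\lambda(h)\in\{-\frac12,\frac12,\frac32,\frac52,\dots\}$, then $U_\lambda$ has two primitive ideals, namely $0$ and $\mathrm{Ann}_{U_\lambda}(L(\lambda))$.
   Context: The Schrödinger algebra $\mathfrak{s}$ is the complex Lie algebra with basis $e,h,f,p,q,z$, with $z$ central and the remaining brackets $[h,e]=2e$, $[e,f]=h$, $[h,f]=-2f$, $[e,q]=p$, $[e,p]=0$, $[h,p]=p$, $[f,p]=q$, $[f,q]=0$, $[h,q]=-q$, $[p,q]=z$. Put $U=U(\mathfrak{s})$, with center $Z(\mathfrak{s})$, $\mathfrak{h}=\mathbb{C}h\oplus\mathbb{C}z$, $\mathfrak{n}_+=\mathbb{C}e\oplus\mathbb{C}p$, $\mathfrak{b}=\mathfrak{h}\oplus\mathfrak{n}_+$. The Verma module is $\Delta(\lambda)=U\otimes_{U(\mathfrak{b})}\mathbb{C}_\lambda$, where $\mathfrak{n}_+$ acts on the one-dimensional module $\mathbb{C}_\lambda$ by $0$ and $\mathfrak{h}$ acts via $\lambda$; $L(\lambda)$ is its unique simple quotient. The center $Z(\mathfrak{s})$ acts on $\Delta(\lambda)$ by scalars. A primitive ideal is the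 annihilator of a simple module. *)

(* Defs.v *)
From HB Require Import structures.
From mathcomp Require Import all_boot all_order all_algebra ring.
From mathcomp Require Import boolp classical_sets.
From mathcomp Require Import generic_quotient ring_quotient.

Set Implicit Arguments.
Unset Strict Implicit.
Unset Printing Implicit Defensive.

Import GRing.Theory.
Local Open Scope ring_scope.
Local Open Scope quotient_scope.

HB.mixin Record Lmodule_isLieAlgebra (K : comNzRingType) L
    of GRing.Lmodule K L := {
  lie : L -> L -> L;
  lie_linearl : forall y, linear (lie^~ y);
  lie_linearr : forall x, linear (lie x);
  liexx : forall x, lie x x = 0;
  lie_jacobi : forall x y z,
    lie x (lie y z) + lie y (lie z x) + lie z (lie x y) = 0
}.

#[short(type="lieAlgType")]
HB.structure Definition LieAlgebra (K : comNzRingType) :=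
  {L of Lmodule_isLieAlgebra K L & GRing.Lmodule K L}.

(* The enveloping algebra of g is the associative unital K-algebra presented
   by the generators UGen x, x in g, the linear relations between them, and
   the relations  x y - y x = [x, y].  It is built as the quotient of the
   syntactic algebra expressions by the least congruence containing the
   algebra axioms and these relations. *)
Section UniversalEnveloping.
Variables (K : comNzRingType) (g : lieAlgType K).

Inductive uterm : Type :=
| UGen of g
| UScal of K
| UAdd of uterm & uterm
| UMul of uterm & uterm.

Definition UOpp t := UMul (UScal (-1)) t.

Inductive ueq : uterm -> uterm -> Prop :=
| ueq_refl s : ueq s s
| ueq_sym s t : ueq s t -> ueq t s
| ueq_trans s t u : ueq s t -> ueq t u -> ueq s u
| ueq_add s s' t t' : ueq s s' -> ueq t t' -> ueq (UAdd s t) (UAdd s' t')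
| ueq_mul s s' t t' : ueq s s' -> ueq t t' -> ueq (UMul s t) (UMul s' t')
| ueq_addA s t u : ueq (UAdd s (UAdd t u)) (UAdd (UAdd s t) u)
| ueq_addC s t : ueq (UAdd s t) (UAdd t s)
| ueq_add0 t : ueq (UAdd (UScal 0) t) t
| ueq_addN t : ueq (UAdd (UOpp t) t) (UScal 0)
| ueq_mulA s t u : ueq (UMul s (UMul t u)) (UMul (UMul s t) u)
| ueq_mul1l t : ueq (UMul (UScal 1) t) t
| ueq_mul1r t : ueq (UMul t (UScal 1)) t
| ueq_mulDl s t u : ueq (UMul (UAdd s t) u) (UAdd (UMul s u) (UMul t u))
| ueq_mulDr s t u : ueq (UMul s (UAdd t u)) (UAdd (UMul s t) (UMul s u))
| ueq_scalD a b : ueq (UScal (a + b)) (UAdd (UScal a) (UScal b))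
| ueq_scalM a b : ueq (UScal (a * b)) (UMul (UScal a) (UScal b))
| ueq_scalC a t : ueq (UMul (UScal a) t) (UMul t (UScal a))
| ueq_genD x y : ueq (UGen (x + y)) (UAdd (UGen x) (UGen y))
| ueq_genZ a x : ueq (UGen (a *: x)) (UMul (UScal a) (UGen x))
| ueq_genL x y : ueq (UAdd (UMul (UGen x) (UGen y))
                           (UOpp (UMul (UGen y) (UGen x)))) (UGen (lie x y)).

Definition ueqb (s t : {classic uterm}) : bool := `[< ueq s t >].

Lemma ueqb_equiv : equiv_class_of ueqb.
Proof.
split=> [s|s t|t s u].
- exact/asboolP/ueq_refl.
- by apply/asboolP/asboolP; exact: ueq_sym.
- by move=> /asboolP st /asboolP tu; apply/asboolP; exact: ueq_trans st tu.
Qed.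

Canonical ueqb_equivRel := EquivRelPack ueqb_equiv.
Canonical ueqb_encModRel := defaultEncModRel ueqb.

Definition univ_env : Type := {eq_quot ueqb}.
HB.instance Definition _ := EqQuotient.on univ_env.
HB.instance Definition _ := Choice.on univ_env.

Definition upi (t : uterm) : univ_env := \pi_univ_env (t : {classic uterm}).
Definition urepr (x : univ_env) : uterm := repr x.

Lemma ureprK x : upi (urepr x) = x. Proof. exact: reprK. Qed.

Lemma upiP s t : upi s = upi t <-> ueq s t.
Proof.
split=> [/eqP|st].
  by rewrite -[_ == _]/(_ == _ %[mod univ_env]) piE => /asboolP.
by apply/eqP; rewrite -[_ == _]/(_ == _ %[mod univ_env]) piE; apply/asboolP.
Qed.

Local Definition uzero := upi (UScal 0).
Local Definition uone := upi (UScal 1).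
Local Definition uadd x y := upi (UAdd (urepr x) (urepr y)).
Local Definition uopp x := upi (UOpp (urepr x)).
Local Definition umul x y := upi (UMul (urepr x) (urepr y)).
Local Definition uscale a x := upi (UMul (UScal a) (urepr x)).

Local Lemma urepr_pi t : ueq (urepr (upi t)) t.
Proof. by apply/upiP; rewrite ureprK. Qed.
Local Lemma uaddE s t : uadd (upi s) (upi t) = upi (UAdd s t).
Proof. by apply/upiP/ueq_add; exact: urepr_pi. Qed.
Local Lemma umulE s t : umul (upi s) (upi t) = upi (UMul s t).
Proof. by apply/upiP/ueq_mul; exact: urepr_pi. Qed.
Local Lemma uoppE t : uopp (upi t) = upi (UOpp t).
Proof. by apply/upiP/ueq_mul; [exact: ueq_refl|exact: urepr_pi]. Qed.
Local Lemma uscaleE a t : uscale a (upi t) = upi (UMul (UScal a) t).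
Proof. by apply/upiP/ueq_mul; [exact: ueq_refl|exact: urepr_pi]. Qed.

Local Lemma uaddA : associative uadd.
Proof.
move=> x y z; rewrite -(ureprK x) -(ureprK y) -(ureprK z) !uaddE.
exact/upiP/ueq_addA.
Qed.
Local Lemma uaddC : commutative uadd.
Proof. by move=> x y; apply/upiP/ueq_addC. Qed.
Local Lemma uadd0 : left_id uzero uadd.
Proof. by move=> x; rewrite -(ureprK x) uaddE; apply/upiP/ueq_add0. Qed.
Local Lemma uaddN : left_inverse uzero uopp uadd.
Proof.
by move=> x; rewrite -(ureprK x) uoppE uaddE; apply/upiP/ueq_addN.
Qed.

HB.instance Definition _ :=
  GRing.isZmodule.Build univ_env uaddA uaddC uadd0 uaddN.

Local Lemma umulA : associative umul.
Proof.
move=> x y z; rewrite -(ureprK x) -(ureprK y) -(ureprK z) !umulE.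
exact/upiP/ueq_mulA.
Qed.
Local Lemma umul1l : left_id uone umul.
Proof. by move=> x; rewrite -(ureprK x) umulE; apply/upiP/ueq_mul1l. Qed.
Local Lemma umul1r : right_id uone umul.
Proof. by move=> x; rewrite -(ureprK x) umulE; apply/upiP/ueq_mul1r. Qed.
Local Lemma umulDl : left_distributive umul uadd.
Proof.
move=> x y z; rewrite -(ureprK x) -(ureprK y) -(ureprK z).
by rewrite !(uaddE, umulE); apply/upiP/ueq_mulDl.
Qed.
Local Lemma umulDr : right_distributive umul uadd.
Proof.
move=> x y z; rewrite -(ureprK x) -(ureprK y) -(ureprK z).
by rewrite !(uaddE, umulE); apply/upiP/ueq_mulDr.
Qed.

Section Evaluation.
Variables (A : algType K) (f : g -> A).

Fixpoint ueval (t : uterm) : A :=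
  match t with
  | UGen x => f x
  | UScal a => a%:A
  | UAdd s t => ueval s + ueval t
  | UMul s t => ueval s * ueval t
  end.

Lemma ueval_eq (f_lin : linear f)
    (f_lie : forall x y, f (lie x y) = f x * f y - f y * f x) s t :
  ueq s t -> ueval s = ueval t.
Proof.
pose F := GRing.isLinear.Build K g A *:%R f f_lin.
pose f' : {linear g -> A} := HB.pack f F.
elim=> {s t} //= *; rewrite ?scaleN1r; try congruence.
- exact: addrA.
- exact: addrC.
- by rewrite scale0r add0r.
- by rewrite mulN1r addNr scale0r.
- exact: mulrA.
- by rewrite scale1r mul1r.
- by rewrite scale1r mulr1.
- exact: mulrDl.
- exact: mulrDr.
- exact: scalerDl.
- by rewrite mulr_algl scalerA.
- by rewrite mulr_algl mulr_algr.
- exact: (linearD f').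
- by rewrite mulr_algl; exact: (linearZZ f').
- by rewrite mulN1r f_lie.
Qed.

End Evaluation.

Local Lemma uone_neq0 : uone != uzero.
Proof.
have lin0 : linear (fun _ : g => 0 : K^o) by move=> a x y; rewrite scaler0 addr0.
have lie0 x y : (fun _ : g => 0 : K^o) (lie x y) = (0 : K^o) * 0 - 0 * 0.
  by rewrite mul0r subrr.
apply/eqP => /upiP /(ueval_eq lin0 lie0) /= /eqP.
by rewrite scale0r scale1r oner_eq0.
Qed.

HB.instance Definition _ := GRing.Zmodule_isNzRing.Build univ_env
  umulA umul1l umul1r umulDl umulDr uone_neq0.

Local Lemma uscaleA a b x : uscale a (uscale b x) = uscale (a * b) x.
Proof.
rewrite -(ureprK x) !uscaleE; apply/upiP.
apply: ueq_trans (ueq_mulA _ _ _) _.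
by apply: ueq_mul (ueq_refl _); apply/ueq_sym/ueq_scalM.
Qed.
Local Lemma uscale1 : left_id 1 uscale.
Proof. by move=> x; rewrite -(ureprK x) uscaleE; apply/upiP/ueq_mul1l. Qed.
Local Lemma uscaleDr : right_distributive uscale +%R.
Proof.
move=> a x y; change (uscale a (uadd x y) = uadd (uscale a x) (uscale a y)).
rewrite -(ureprK x) -(ureprK y) !(uaddE, uscaleE).
exact/upiP/ueq_mulDr.
Qed.
Local Lemma uscaleDl x : {morph uscale^~ x : a b / a + b}.
Proof.
move=> a b; change (uscale (a + b) x = uadd (uscale a x) (uscale b x)).
rewrite -(ureprK x) !(uaddE, uscaleE); apply/upiP.
exact: ueq_trans (ueq_mul (ueq_scalD _ _) (ueq_refl _)) (ueq_mulDl _ _ _).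
Qed.

HB.instance Definition _ := GRing.Zmodule_isLmodule.Build K univ_env
  uscaleA uscale1 uscaleDr uscaleDl.

Local Lemma uscaleAl (a : K) (x y : univ_env) : a *: (x * y) = (a *: x) * y.
Proof.
change (uscale a (umul x y) = umul (uscale a x) y).
rewrite -(ureprK x) -(ureprK y) !(umulE, uscaleE).
exact/upiP/ueq_mulA.
Qed.

HB.instance Definition _ := GRing.Lmodule_isLalgebra.Build K univ_env uscaleAl.

Local Lemma uscaleAr (a : K) (x y : univ_env) : a *: (x * y) = x * (a *: y).
Proof.
change (uscale a (umul x y) = umul x (uscale a y)).
rewrite -(ureprK x) -(ureprK y) !(umulE, uscaleE); apply/upiP.
apply: ueq_trans (ueq_mulA _ _ _) _.
apply: ueq_trans (ueq_mul (ueq_scalC _ _) (ueq_refl _)) _.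
exact/ueq_sym/ueq_mulA.
Qed.

HB.instance Definition _ := GRing.Lalgebra_isAlgebra.Build K univ_env uscaleAr.

Definition uiota (x : g) : univ_env := upi (UGen x).

Lemma upiD s t : upi (UAdd s t) = upi s + upi t.
Proof. by rewrite -uaddE. Qed.
Lemma upiM s t : upi (UMul s t) = upi s * upi t.
Proof. by rewrite -umulE. Qed.
Lemma upi_scal a : upi (UScal a) = a%:A.
Proof.
change (upi (UScal a) = uscale a uone); rewrite uscaleE.
exact/upiP/ueq_sym/ueq_mul1r.
Qed.

Lemma uiota_is_linear : linear uiota.
Proof.
move=> a x y; rewrite /uiota -mulr_algl -upi_scal -upiM -upiD; apply/upiP.
apply: ueq_trans (ueq_genD _ _) _.
exact: ueq_add (ueq_genZ _ _) (ueq_refl _).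
Qed.
HB.instance Definition _ :=
  GRing.isLinear.Build K g univ_env *:%R uiota uiota_is_linear.

Lemma uiota_lie x y :
  uiota (lie x y) = uiota x * uiota y - uiota y * uiota x.
Proof.
rewrite /uiota -mulN1r -scaleN1r -upi_scal -!upiM -upiD.
exact/upiP/ueq_sym/ueq_genL.
Qed.

Section UniversalProperty.
Variables (A : algType K) (f : {linear g -> A}).
Hypothesis f_lie : forall x y, f (lie x y) = f x * f y - f y * f x.

Definition ulift & (forall x y, f (lie x y) = f x * f y - f y * f x) :=
  fun x : univ_env => ueval f (urepr x).
Local Notation F := (ulift f_lie).

Lemma ulift_pi t : F (upi t) = ueval f t.
Proof.
by rewrite /ulift; apply: ueval_eq (urepr_pi t) => //; exact: linearP.
Qed.

Lemma ulift_iota x : F (uiota x) = f x.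
Proof. exact: ulift_pi. Qed.

Lemma ulift_is_linear : linear F.
Proof.
move=> a x y; rewrite -(ureprK x) -(ureprK y) -mulr_algl -upi_scal.
by rewrite -upiM -upiD !ulift_pi /= mulr_algl.
Qed.
HB.instance Definition _ :=
  GRing.isLinear.Build K univ_env A *:%R F ulift_is_linear.

Lemma ulift_is_monoid_morphism : monoid_morphism F.
Proof.
split=> [|x y]; first by rewrite -[1]/(upi (UScal 1)) ulift_pi /= scale1r.
by rewrite -(ureprK x) -(ureprK y) -upiM !ulift_pi.
Qed.
HB.instance Definition _ :=
  GRing.isMonoidMorphism.Build univ_env A F ulift_is_monoid_morphism.

Lemma ulift_unique (F' : {lrmorphism univ_env -> A}) :
  (forall x, F' (uiota x) = f x) -> F' =1 F.
Proof.
move=> F'f x; rewrite -(ureprK x) ulift_pi.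
elim: (urepr x) => [y|a|s IHs t IHt|s IHs t IHt].
- exact: F'f.
- by rewrite upi_scal linearZ rmorph1.
- by rewrite upiD rmorphD [LHS](congr2 +%R IHs IHt).
- by rewrite upiM rmorphM [LHS](congr2 *%R IHs IHt).
Qed.

End UniversalProperty.

End UniversalEnveloping.

Section QuotientModule.
Variables (A : pzRingType) (M : lmodType A) (N : submodClosed M).

Definition submod_pred : {pred M} := N.
Lemma submod_pred_zmod_closed : zmod_closed submod_pred.
Proof.
split=> [|x y xN yN]; first exact: (@rpred0 _ N).
by rewrite -scaleN1r; apply: (@rpredD _ N); rewrite ?(@rpredZ _ _ N).
Qed.
HB.instance Definition _ := GRing.isZmodClosed.Build M submod_pred
  submod_pred_zmod_closed.

Definition quot_mod : Type := {ideal_quot submod_pred}.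
HB.instance Definition _ := GRing.Zmodule.on quot_mod.
HB.instance Definition _ := EqQuotient.on quot_mod.

Local Definition qscale a (x : quot_mod) : quot_mod := \pi_quot_mod (a *: repr x).

Local Lemma qscale_pi a m :
  qscale a (\pi_quot_mod m) = \pi_quot_mod (a *: m).
Proof.
have mN : repr (\pi_quot_mod m) - m \in submod_pred.
  by rewrite Quotient.idealrBE reprK.
apply/eqP; rewrite -Quotient.idealrBE -scalerBr.
exact: (@rpredZ _ _ N).
Qed.

Local Lemma mpiD m n :
  \pi_quot_mod (m + n) = \pi_quot_mod m + \pi_quot_mod n.
Proof. exact: (raddfD (\pi_{ideal_quot submod_pred})). Qed.

Local Lemma qscaleA a b x : qscale a (qscale b x) = qscale (a * b) x.
Proof. by rewrite [qscale b x]/qscale qscale_pi scalerA. Qed.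
Local Lemma qscale1 : left_id 1 qscale.
Proof. by move=> x; rewrite /qscale scale1r reprK. Qed.
Local Lemma qscaleDr : right_distributive qscale +%R.
Proof.
move=> a; elim/quotW=> m; elim/quotW=> n.
by rewrite (qscale_pi a m) (qscale_pi a n) -(mpiD m n) (qscale_pi a) scalerDr mpiD.
Qed.
Local Lemma qscaleDl x : {morph qscale^~ x : a b / a + b}.
Proof. by move=> a b; rewrite /qscale scalerDl mpiD. Qed.

HB.instance Definition _ := GRing.Zmodule_isLmodule.Build A quot_mod
  qscaleA qscale1 qscaleDr qscaleDl.

Definition quot_mod_pi (m : M) : quot_mod := \pi_quot_mod m.
Lemma quot_mod_pi_is_linear : linear quot_mod_pi.
Proof. by move=> a m n; rewrite /quot_mod_pi mpiD -qscale_pi. Qed.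
HB.instance Definition _ :=
  GRing.isLinear.Build A M quot_mod *:%R quot_mod_pi quot_mod_pi_is_linear.

Lemma quot_mod_pi_eq0 m : (quot_mod_pi m == 0) = (m \in N).
Proof.
rewrite -[0](linear0 quot_mod_pi) -Quotient.idealrBE subr0.
by [].
Qed.

End QuotientModule.

HB.mixin Record isTwoSided (A : pzRingType) (I : {pred A}) := {
  idealMl : forall a x, x \in I -> a * x \in I;
  idealMr : forall a x, x \in I -> x * a \in I
}.

#[short(type="twoSidedIdeal")]
HB.structure Definition TwoSidedIdeal (A : pzRingType) :=
  {I of GRing.ZmodClosed A I & isTwoSided A I}.

Section QuotientRing.
Variables (A : pzRingType) (I : twoSidedIdeal A).

Definition quot_ring : Type := {ideal_quot I}.
HB.instance Definition _ := GRing.Zmodule.on quot_ring.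
HB.instance Definition _ := EqQuotient.on quot_ring.

Local Definition qone : quot_ring := \pi_quot_ring 1.
Local Definition qmul (x y : quot_ring) : quot_ring := \pi_quot_ring (repr x * repr y).

Local Lemma qmul_pi a b :
  qmul (\pi_quot_ring a) (\pi_quot_ring b) = \pi_quot_ring (a * b).
Proof.
apply/eqP; rewrite -Quotient.idealrBE.
set a' := repr _; set b' := repr _.
have -> : a' * b' - a * b = a' * (b' - b) + (a' - a) * b.
  by rewrite mulrBr mulrBl addrA subrK.
apply: rpredD; [apply: idealMl | apply: idealMr].
  by rewrite Quotient.idealrBE reprK.
by rewrite Quotient.idealrBE reprK.
Qed.

Local Lemma qpiD a b :
  \pi_quot_ring (a + b) = \pi_quot_ring a + \pi_quot_ring b.
Proof. exact: (raddfD (\pi_{ideal_quot I})). Qed.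

Local Lemma qmulA : associative qmul.
Proof.
elim/quotW=> a; elim/quotW=> b; elim/quotW=> c.
by rewrite (qmul_pi b c) (qmul_pi a b) (qmul_pi a) (qmul_pi _ c) mulrA.
Qed.
Local Lemma qmul1l : left_id qone qmul.
Proof. by elim/quotW=> a; rewrite (qmul_pi 1 a) mul1r. Qed.
Local Lemma qmul1r : right_id qone qmul.
Proof. by elim/quotW=> a; rewrite (qmul_pi a 1) mulr1. Qed.
Local Lemma qmulDl : left_distributive qmul +%R.
Proof.
elim/quotW=> a; elim/quotW=> b; elim/quotW=> c.
rewrite (qmul_pi a c) (qmul_pi b c).
by rewrite -(qpiD a b) (qmul_pi _ c) mulrDl qpiD.
Qed.
Local Lemma qmulDr : right_distributive qmul +%R.
Proof.
elim/quotW=> a; elim/quotW=> b; elim/quotW=> c.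
by rewrite (qmul_pi a b) (qmul_pi a c) -(qpiD b c) (qmul_pi a) mulrDr qpiD.
Qed.

HB.instance Definition _ := GRing.Zmodule_isPzRing.Build quot_ring
  qmulA qmul1l qmul1r qmulDl qmulDr.

Definition quot_ring_pi (a : A) : quot_ring := \pi_quot_ring a.
Lemma quot_ring_pi_is_zmod_morphism : zmod_morphism quot_ring_pi.
Proof. exact: (raddfB (\pi_{ideal_quot I})). Qed.
HB.instance Definition _ := GRing.isZmodMorphism.Build A quot_ring
  quot_ring_pi quot_ring_pi_is_zmod_morphism.
Lemma quot_ring_pi_is_monoid_morphism : monoid_morphism quot_ring_pi.
Proof. by split=> [//|a b]; rewrite /quot_ring_pi -qmul_pi. Qed.
HB.instance Definition _ := GRing.isMonoidMorphism.Build A quot_ring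
  quot_ring_pi quot_ring_pi_is_monoid_morphism.

Lemma quot_ring_pi_eq0 a : (quot_ring_pi a == 0) = (a \in I).
Proof. by rewrite -[0](raddf0 quot_ring_pi) -Quotient.idealrBE subr0. Qed.

(* A left A-module killed by I, regarded as a module over A / I. *)
Section Descent.
Variables (M : lmodType A).

Definition descent & (forall a m, a \in I -> a *: (m : M) = 0) : Type := M.
Hypothesis killM : forall a m, a \in I -> a *: (m : M) = 0.
HB.instance Definition _ := GRing.Zmodule.on (descent killM).

Local Definition dscale (x : quot_ring) (m : descent killM) : descent killM :=
  repr x *: (m : M).

Local Lemma dscale_pi a m : dscale (\pi_quot_ring a) m = a *: (m : M).
Proof.
apply/eqP; rewrite -subr_eq0 -scalerBl killM //.
by rewrite Quotient.idealrBE reprK.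
Qed.

Local Lemma dscaleA x y m : dscale x (dscale y m) = dscale (x * y) m.
Proof. by rewrite [x * y]/(qmul x y) dscale_pi /dscale scalerA. Qed.
Local Lemma dscale1 : left_id 1 dscale.
Proof. by move=> m; exact: etrans (dscale_pi 1 m) (scale1r _). Qed.
Local Lemma dscaleDr : right_distributive dscale +%R.
Proof. by move=> x m n; rewrite /dscale scalerDr. Qed.
Local Lemma dscaleDl m : {morph dscale^~ m : x y / x + y}.
Proof.
elim/quotW=> a; elim/quotW=> b /=.
by rewrite -(qpiD a b) !dscale_pi scalerDl.
Qed.

HB.instance Definition _ := GRing.Zmodule_isLmodule.Build quot_ring
  (descent killM) dscaleA dscale1 dscaleDr dscaleDl.

Lemma descentZ a (m : descent killM) : quot_ring_pi a *: m = a *: (m : M).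
Proof. exact: dscale_pi. Qed.

End Descent.
End QuotientRing.

Section RestrictionOfScalars.
Variables (A B : pzRingType) (phi : {rmorphism A -> B}) (M : lmodType B).

Definition restrict & {rmorphism A -> B} : Type := M.
Local Notation N := (restrict phi).
HB.instance Definition _ := GRing.Zmodule.on N.

Local Definition rscale (a : A) (m : N) : N := phi a *: (m : M).

Local Lemma rscaleA a b m : rscale a (rscale b m) = rscale (a * b) m.
Proof. by rewrite /rscale scalerA rmorphM. Qed.
Local Lemma rscale1 : left_id 1 rscale.
Proof. by move=> m; rewrite /rscale rmorph1 scale1r. Qed.
Local Lemma rscaleDr : right_distributive rscale +%R.
Proof. by move=> a m n; rewrite /rscale scalerDr. Qed.
Local Lemma rscaleDl m : {morph rscale^~ m : a b / a + b}.
Proof. by move=> a b; rewrite /rscale rmorphD scalerDl. Qed.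

HB.instance Definition _ := GRing.Zmodule_isLmodule.Build A N
  rscaleA rscale1 rscaleDr rscaleDl.

Lemma restrictZ a (m : N) : a *: m = phi a *: (m : M).
Proof. by []. Qed.

End RestrictionOfScalars.
Arguments restrict {A B} M phi.

(* The left B-module B (x)_A M, where B is a right A-module through phi: the
   abelian group generated by the tensors TTens b m subject to biadditivity
   and to  (b phi(a)) (x) m = b (x) (a m). *)
Section TensorProduct.
Variables (A B : pzRingType) (phi : {rmorphism A -> B}) (M : lmodType A).

Inductive tterm : Type :=
| TTens of B & M
| TZero
| TOpp of tterm
| TAdd of tterm & tterm.

Inductive teq : tterm -> tterm -> Prop :=
| teq_refl s : teq s s
| teq_sym s t : teq s t -> teq t s
| teq_trans s t u : teq s t -> teq t u -> teq s u
| teq_opp s t : teq s t -> teq (TOpp s) (TOpp t)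
| teq_add s s' t t' : teq s s' -> teq t t' -> teq (TAdd s t) (TAdd s' t')
| teq_addA s t u : teq (TAdd s (TAdd t u)) (TAdd (TAdd s t) u)
| teq_addC s t : teq (TAdd s t) (TAdd t s)
| teq_add0 t : teq (TAdd TZero t) t
| teq_addN t : teq (TAdd (TOpp t) t) TZero
| teq_tensDl b b' m :
    teq (TTens (b + b') m) (TAdd (TTens b m) (TTens b' m))
| teq_tensDr b m m' :
    teq (TTens b (m + m')) (TAdd (TTens b m) (TTens b m'))
| teq_balanced b a m : teq (TTens (b * phi a) m) (TTens b (a *: m)).

Definition teqb (s t : {classic tterm}) : bool := `[< teq s t >].

Lemma teqb_equiv : equiv_class_of teqb.
Proof.
split=> [s|s t|t s u].
- exact/asboolP/teq_refl.
- by apply/asboolP/asboolP; exact: teq_sym.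
- by move=> /asboolP st /asboolP tu; apply/asboolP; exact: teq_trans st tu.
Qed.

Canonical teqb_equivRel := EquivRelPack teqb_equiv.
Canonical teqb_encModRel := defaultEncModRel teqb.

Definition tensor : Type := {eq_quot teqb}.
HB.instance Definition _ := EqQuotient.on tensor.
HB.instance Definition _ := Choice.on tensor.

Definition tpi (t : tterm) : tensor := \pi_tensor (t : {classic tterm}).
Definition trepr (x : tensor) : tterm := repr x.

Lemma treprK x : tpi (trepr x) = x. Proof. exact: reprK. Qed.

Lemma tpiP s t : tpi s = tpi t <-> teq s t.
Proof.
split=> [/eqP|st].
  by rewrite -[_ == _]/(_ == _ %[mod tensor]) piE => /asboolP.
by apply/eqP; rewrite -[_ == _]/(_ == _ %[mod tensor]) piE; apply/asboolP.
Qed.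

Local Definition tzero := tpi TZero.
Local Definition tadd x y := tpi (TAdd (trepr x) (trepr y)).
Local Definition topp x := tpi (TOpp (trepr x)).

Local Lemma trepr_pi t : teq (trepr (tpi t)) t.
Proof. by apply/tpiP; rewrite treprK. Qed.
Local Lemma taddE s t : tadd (tpi s) (tpi t) = tpi (TAdd s t).
Proof. by apply/tpiP/teq_add; exact: trepr_pi. Qed.
Local Lemma toppE t : topp (tpi t) = tpi (TOpp t).
Proof. by apply/tpiP/teq_opp; exact: trepr_pi. Qed.

Local Lemma taddA : associative tadd.
Proof.
move=> x y z; rewrite -(treprK x) -(treprK y) -(treprK z) !taddE.
exact/tpiP/teq_addA.
Qed.
Local Lemma taddC : commutative tadd.
Proof. by move=> x y; apply/tpiP/teq_addC. Qed.
Local Lemma tadd0 : left_id tzero tadd.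
Proof. by move=> x; rewrite -(treprK x) taddE; apply/tpiP/teq_add0. Qed.
Local Lemma taddN : left_inverse tzero topp tadd.
Proof.
by move=> x; rewrite -(treprK x) toppE taddE; apply/tpiP/teq_addN.
Qed.

HB.instance Definition _ :=
  GRing.isZmodule.Build tensor taddA taddC tadd0 taddN.

Lemma tpi0 : tpi TZero = 0. Proof. by []. Qed.
Lemma tpiD s t : tpi (TAdd s t) = tpi s + tpi t.
Proof. by rewrite -taddE. Qed.
Lemma tpiN t : tpi (TOpp t) = - tpi t.
Proof. by rewrite -toppE. Qed.

Fixpoint tmul (c : B) (t : tterm) : tterm :=
  match t with
  | TTens b m => TTens (c * b) m
  | TZero => TZero
  | TOpp t => TOpp (tmul c t)
  | TAdd s t => TAdd (tmul c s) (tmul c t)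
  end.

Local Lemma tmul_eq c s t : teq s t -> teq (tmul c s) (tmul c t).
Proof.
elim=> /= {s t}; try by econstructor; eauto.
- by move=> b b' m; rewrite mulrDr; exact: teq_tensDl.
- by move=> b a m; rewrite mulrA; exact: teq_balanced.
Qed.

Local Definition tscale c x := tpi (tmul c (trepr x)).
Local Lemma tscaleE c t : tscale c (tpi t) = tpi (tmul c t).
Proof. by apply/tpiP/tmul_eq/trepr_pi. Qed.

Local Lemma tscaleA a b x : tscale a (tscale b x) = tscale (a * b) x.
Proof.
rewrite -(treprK x) !tscaleE; congr tpi.
by elim: (trepr x) => [c m||t /= ->|s /= -> t ->] //=; rewrite mulrA.
Qed.
Local Lemma tscale1 : left_id 1 tscale.
Proof.
move=> x; rewrite -(treprK x) !tscaleE; congr tpi.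
by elim: (trepr x) => [c m||t /= ->|s /= -> t ->] //=; rewrite mul1r.
Qed.
Local Lemma tscaleDr : right_distributive tscale +%R.
Proof.
move=> a x y; rewrite -(treprK x) -(treprK y) -tpiD !tscaleE /=.
exact: tpiD.
Qed.
Local Lemma tscaleDl x : {morph tscale^~ x : a b / a + b}.
Proof.
move=> a b /=; rewrite -(treprK x) !tscaleE.
elim: (trepr x) => [c m||t IHt|s IHs t IHt].
- rewrite -tpiD; apply/tpiP => /=; rewrite mulrDl; exact: teq_tensDl.
- by rewrite /= tpi0 addr0.
- by rewrite /= !tpiN -opprD [LHS](congr1 -%R IHt).
- by rewrite /= !tpiD [LHS](congr2 +%R IHs IHt) addrACA.
Qed.

HB.instance Definition _ := GRing.Zmodule_isLmodule.Build B tensor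
  tscaleA tscale1 tscaleDr tscaleDl.

Definition tens (b : B) (m : M) : tensor := tpi (TTens b m).

Lemma tensDl b b' m : tens (b + b') m = tens b m + tens b' m.
Proof. by rewrite /tens -tpiD; apply/tpiP/teq_tensDl. Qed.
Lemma tensDr b m m' : tens b (m + m') = tens b m + tens b m'.
Proof. by rewrite /tens -tpiD; apply/tpiP/teq_tensDr. Qed.
Lemma tens_balanced b a m : tens (b * phi a) m = tens b (a *: m).
Proof. exact/tpiP/teq_balanced. Qed.
Lemma tensZ c b m : c *: tens b m = tens (c * b) m.
Proof. exact: tscaleE. Qed.

End TensorProduct.

Section ModuleTheory.
Variable A : pzRingType.

Definition simple_module (M : lmodType A) : Prop :=
  (exists m : M, m != 0) /\
  forall N : submodClosed M, N =i pred1 0 \/ N =i predT.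

(* In the algebras considered below the scalars are elements of A, so that
   ideals are automatically subspaces. *)
Definition simple_algebra : Prop :=
  1 != 0 :> A /\ forall I : twoSidedIdeal A, I =i pred1 0 \/ I =i predT.

Definition annihilator (M : lmodType A) : {pred A} :=
  fun a => `[< forall m : M, a *: m = 0 >].

Definition primitive_ideal (I : {pred A}) : Prop :=
  exists2 M : lmodType A, simple_module M & I =i annihilator M.

Definition center : set A := [set c | forall a, c * a = a * c].

End ModuleTheory.

Section SimpleQuotient.
Variables (A : pzRingType) (M : lmodType A).

Definition zero_sub : {pred M} := pred1 0.
Lemma zero_sub_closed : submod_closed zero_sub.
Proof.
split=> [|a x y]; first by rewrite unfold_in.
by rewrite !unfold_in => /eqP -> /eqP ->; rewrite scaler0 addr0.
Qed.
HB.instance Definition _ := GRing.isSubmodClosed.Build A M zero_sub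
  (GRing.submod_closed_semi zero_sub_closed).

(* The kernel of the projection of M onto its simple quotient.  It is meant to
   be used for a module M with exactly one simple quotient; the zero submodule
   is a dummy value for when there is none. *)
Definition simple_quotient_kernel : submodClosed M :=
  if pselect (exists N : submodClosed M, simple_module (quot_mod N))
  is left exN then projT1 (cid exN) else zero_sub.

Definition simple_quotient : lmodType A := quot_mod simple_quotient_kernel.

End SimpleQuotient.

Section Schrodinger.
Variable K : fieldType.

Definition schrodinger : Type := 'rV[K]_6.
HB.instance Definition _ := Vector.on schrodinger.

Local Notation ie := (@Ordinal 6 0 isT).
Local Notation ih := (@Ordinal 6 1 isT).
Local Notation iF := (@Ordinal 6 2 isT).
Local Notation ip := (@Ordinal 6 3 isT).
Local Notation iq := (@Ordinal 6 4 isT).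
Local Notation iz := (@Ordinal 6 5 isT).

Definition se : schrodinger := delta_mx 0 ie.
Definition sh : schrodinger := delta_mx 0 ih.
Definition sf : schrodinger := delta_mx 0 iF.
Definition sp : schrodinger := delta_mx 0 ip.
Definition sq : schrodinger := delta_mx 0 iq.
Definition sz : schrodinger := delta_mx 0 iz.

Definition sbracket (x y : schrodinger) : schrodinger :=
  let minor i j : K := x 0 i * y 0 j - x 0 j * y 0 i in
    minor ih ie *: (2 *: se) + minor ie iF *: sh + minor ih iF *: (- 2 *: sf)
  + minor ie iq *: sp + minor ih ip *: sp
  + minor iF ip *: sq + minor ih iq *: (- sq)
  + minor ip iq *: sz.

Local Lemma schrP (x y : schrodinger) :
  x 0 ie = y 0 ie -> x 0 ih = y 0 ih -> x 0 iF = y 0 iF ->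
  x 0 ip = y 0 ip -> x 0 iq = y 0 iq -> x 0 iz = y 0 iz -> x = y.
Proof.
move=> *; apply/rowP; case=> [[|[|[|[|[|[|//]]]]]] lti].
all: by rewrite (bool_irrelevance lti isT).
Qed.

Local Lemma sbracketE (x y : schrodinger)
    (m := fun i j : 'I_6 => x 0 i * y 0 j - x 0 j * y 0 i) :
  (sbracket x y 0 ie = 2 * m ih ie) * (sbracket x y 0 ih = m ie iF) *
  (sbracket x y 0 iF = - 2 * m ih iF) *
  (sbracket x y 0 ip = m ie iq + m ih ip) *
  (sbracket x y 0 iq = m iF ip - m ih iq) * (sbracket x y 0 iz = m ip iq).
Proof.
rewrite /m /sbracket; do !split; rewrite !mxE !eqE /=.
all: ring.
Qed.

Local Lemma schrD (x y : schrodinger) i : (x + y) 0 i = x 0 i + y 0 i.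
Proof. exact: mxE. Qed.
Local Lemma schrZ a (x : schrodinger) i : (a *: x) 0 i = a * x 0 i.
Proof. exact: mxE. Qed.
Local Lemma schrN (x : schrodinger) i : (- x) 0 i = - x 0 i.
Proof. exact: mxE. Qed.
Local Lemma schr0 i : (0 : schrodinger) 0 i = 0.
Proof. exact: mxE. Qed.
Local Definition schrE := (schrD, schrZ, schrN, schr0).

Local Lemma sbracket_linearl y : linear (sbracket^~ y).
Proof.
move=> a x x'.
change (sbracket (a *: x + x') y = a *: sbracket x y + sbracket x' y).
by apply: schrP; rewrite !(schrE, sbracketE); ring.
Qed.
Local Lemma sbracket_linearr x : linear (sbracket x).
Proof.
move=> a y y'.
change (sbracket x (a *: y + y') = a *: sbracket x y + sbracket x y').
by apply: schrP; rewrite !(schrE, sbracketE); ring.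
Qed.
Local Lemma sbracketxx x : sbracket x x = 0.
Proof. by apply: schrP; rewrite !(schrE, sbracketE); ring. Qed.
Local Lemma sbracket_jacobi x y z :
  sbracket x (sbracket y z) + sbracket y (sbracket z x)
  + sbracket z (sbracket x y) = 0.
Proof. by apply: schrP; rewrite !(schrE, sbracketE); ring. Qed.

HB.instance Definition _ := Lmodule_isLieAlgebra.Build K schrodinger
  sbracket_linearl sbracket_linearr sbracketxx sbracket_jacobi.

Lemma schr_lieE (x y : schrodinger) : lie x y = sbracket x y.
Proof. by []. Qed.

Lemma schrodinger_brackets :
  (lie sh se = 2 *: se) * (lie se sf = sh) * (lie sh sf = - 2 *: sf) *
  (lie se sq = sp) * (lie se sp = 0) * (lie sh sp = sp) *
  (lie sf sp = sq) * (lie sf sq = 0) * (lie sh sq = - sq) *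
  (lie sp sq = sz) * (forall x : schrodinger, lie sz x = 0).
Proof.
do !split; try move=> x; rewrite schr_lieE.
all: rewrite /sbracket !mxE !eqE /= ?(mulr0, mul0r, mulr1, subr0, subrr).
all: by rewrite ?(scale0r, scale1r, add0r, addr0).
Qed.

Definition cartan : {vspace schrodinger} := (<[sh]> + <[sz]>)%VS.
Definition nplus : {vspace schrodinger} := (<[se]> + <[sp]>)%VS.
Definition borel : {vspace schrodinger} := (cartan + nplus)%VS.

Local Lemma cartanP (x : schrodinger) :
  reflect (x = x 0 ih *: sh + x 0 iz *: sz) (x \in cartan).
Proof.
apply: (iffP idP) => [/memv_addP[_ /vlineP[a ->] [_ /vlineP[b ->] ->]]|->].
  by apply: schrP; rewrite !schrE !mxE !eqE /=; ring.
by rewrite memv_add ?memvZ ?memv_line.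
Qed.

Local Lemma nplusP (x : schrodinger) :
  reflect (x = x 0 ie *: se + x 0 ip *: sp) (x \in nplus).
Proof.
apply: (iffP idP) => [/memv_addP[_ /vlineP[a ->] [_ /vlineP[b ->] ->]]|->].
  by apply: schrP; rewrite !schrE !mxE !eqE /=; ring.
by rewrite memv_add ?memvZ ?memv_line.
Qed.

Local Lemma cartan0 (x : schrodinger) : x \in cartan ->
  (x 0 ie = 0) * (x 0 iF = 0) * (x 0 ip = 0) * (x 0 iq = 0).
Proof. by move=> /cartanP ->; rewrite !schrE !mxE !eqE /= !mulr0 !addr0. Qed.

Local Lemma nplus0 (x : schrodinger) : x \in nplus ->
  (x 0 ih = 0) * (x 0 iF = 0) * (x 0 iz = 0) * (x 0 iq = 0).
Proof. by move=> /nplusP ->; rewrite !schrE !mxE !eqE /= !mulr0 !addr0. Qed.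

Local Lemma borel0 (x : schrodinger) :
  x \in borel -> (x 0 iF = 0) * (x 0 iq = 0).
Proof.
move=> /memv_addP[u /cartan0 u0 [v /nplus0 v0 ->]].
by rewrite !schrE !u0 !v0 addr0.
Qed.

Lemma sh_cartan : sh \in cartan.
Proof. by rewrite (subvP (addvSl _ _)) ?memv_line. Qed.
Lemma sz_cartan : sz \in cartan.
Proof. by rewrite (subvP (addvSr _ _)) ?memv_line. Qed.

Lemma cartan_nplus : (cartan :&: nplus = 0)%VS.
Proof.
apply/eqP; rewrite -subv0; apply/subvP => x; rewrite memv_cap memv0.
move=> /andP[/cartan0 x0 /nplus0 x0']; apply/eqP.
by apply: schrP; rewrite ?x0 ?x0' mxE.
Qed.

Lemma borel_lie_nplus (x y : schrodinger) :
  x \in borel -> y \in borel -> lie x y \in nplus.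
Proof.
move=> /borel0 x0 /borel0 y0; apply/nplusP; rewrite schr_lieE.
apply: schrP; rewrite !(schrE, sbracketE) !mxE !eqE /= !x0 !y0; ring.
Qed.

Lemma borel_lie (x y : schrodinger) :
  x \in borel -> y \in borel -> lie x y \in borel.
Proof.
by move=> xb yb; apply: (subvP (addvSr _ _)); exact: borel_lie_nplus.
Qed.

Definition borel_alg : Type := subvs_of borel.
HB.instance Definition _ := Vector.on borel_alg.

Local Definition blie (x y : borel_alg) : borel_alg :=
  vsproj borel (lie (vsval x) (vsval y)).

Local Lemma vsval_blie x y : vsval (blie x y) = lie (vsval x) (vsval y).
Proof. by rewrite vsprojK // borel_lie ?subvsP. Qed.

Local Lemma blie_linearl y : linear (blie^~ y).
Proof.
move=> a x x'; apply: subvs_inj.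
rewrite linearP /= !vsval_blie linearP /=.
exact: (lie_linearl (vsval y) a (vsval x) (vsval x')).
Qed.
Local Lemma blie_linearr x : linear (blie x).
Proof.
move=> a y y'; apply: subvs_inj.
rewrite linearP /= !vsval_blie linearP /=.
exact: (lie_linearr (vsval x) a (vsval y) (vsval y')).
Qed.
Local Lemma bliexx x : blie x x = 0.
Proof. by apply: subvs_inj; rewrite vsval_blie liexx linear0. Qed.
Local Lemma blie_jacobi x y z :
  blie x (blie y z) + blie y (blie z x) + blie z (blie x y) = 0.
Proof.
by apply: subvs_inj; rewrite !linearD linear0 /= !vsval_blie lie_jacobi.
Qed.

HB.instance Definition _ := Lmodule_isLieAlgebra.Build K borel_alg
  blie_linearl blie_linearr bliexx blie_jacobi.

Local Notation U := (univ_env schrodinger).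
Local Notation Ub := (univ_env borel_alg).

Definition borel_gen (x : borel_alg) : U := uiota (vsval x).

Lemma borel_gen_is_linear : linear borel_gen.
Proof. by move=> a x y; rewrite /borel_gen !linearP. Qed.
HB.instance Definition _ :=
  GRing.isLinear.Build K borel_alg U *:%R borel_gen borel_gen_is_linear.

Lemma borel_gen_lie x y : borel_gen (lie x y) =
  borel_gen x * borel_gen y - borel_gen y * borel_gen x.
Proof. by rewrite /borel_gen vsval_blie uiota_lie. Qed.

Definition borel_env : {lrmorphism Ub -> U} := ulift borel_gen_lie.

Definition hC : subvs_of cartan := vsproj cartan sh.
Definition zC : subvs_of cartan := vsproj cartan sz.

Section Verma.
Variable lambda : {scalar subvs_of cartan}.

(* The action of b on C_lambda: daddv_pi is the projection of b onto h along
   n_+. *)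
Definition weight (x : borel_alg) : K^o :=
  lambda (vsproj cartan (daddv_pi cartan nplus (vsval x))).

Lemma weight_cartan (x : borel_alg) (xh : vsval x \in cartan) :
  weight x = lambda (Subvs xh).
Proof.
rewrite /weight daddv_pi_id //; last exact: cartan_nplus.
by congr (lambda _); apply: subvs_inj; rewrite vsprojK.
Qed.

Lemma weight_nplus (x : borel_alg) : vsval x \in nplus -> weight x = 0.
Proof.
move=> xn; rewrite /weight.
have := daddv_pi_add cartan_nplus (subvsP x).
rewrite (@daddv_pi_id _ _ nplus cartan) ?xn //; last first.
  by rewrite capvC cartan_nplus.
by move=> /(canRL (addrK _)) ->; rewrite subrr !linear0.
Qed.

Lemma weight_is_linear : linear weight.
Proof. by move=> a x y; rewrite /weight !linearP. Qed.
HB.instance Definition _ :=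
  GRing.isLinear.Build K borel_alg K^o *:%R weight weight_is_linear.

Lemma weight_lie x y :
  weight (lie x y) = weight x * weight y - weight y * weight x.
Proof.
rewrite mulrC subrr weight_nplus // vsval_blie.
by rewrite borel_lie_nplus ?subvsP.
Qed.

Definition weight_env : {lrmorphism Ub -> K^o} := ulift weight_lie.

Definition weight_module : lmodType Ub := restrict (K^o)^o weight_env.

Definition verma : lmodType U := tensor borel_env weight_module.

Definition simple_highest_weight : lmodType U := simple_quotient verma.

(* m_lambda: the centre of U acts on the Verma module by scalars, hence its
   annihilator in the centre is a maximal ideal of the centre, and the only one
   annihilating the Verma module. *)
Definition central_annihilator : set U :=
  [set c | center c /\ forall v : verma, c *: v = 0].

(* U m_lambda: finite sums of elements u c, u in U, c in m_lambda. *)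
Definition central_ideal : {pred U} := fun x =>
  `[< exists n (u c : 'I_n -> U), (forall i, central_annihilator (c i)) /\
        x = \sum_i u i * c i >].

Lemma central_ideal_zmod_closed : zmod_closed central_ideal.
Proof.
split=> [|x y].
  by apply/asboolP; exists 0, (fun=> 0), (fun=> 0); rewrite big_ord0; split=> // -[].
move=> /asboolP[n [u [c [cm ->]]]] /asboolP[n' [u' [c' [cm' ->]]]].
apply/asboolP; exists (n + n')%N.
exists (fun i => match split i with inl j => u j | inr j => - u' j end).
exists (fun i => match split i with inl j => c j | inr j => c' j end).
split=> [i|]; first by case: split.
rewrite big_split_ord /=; congr (_ + _); first apply: eq_bigr => i _.
  by rewrite (unsplitK (inl i)).
rewrite -sumrN; apply: eq_bigr => i _.
by rewrite (unsplitK (inr i)) mulNr.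
Qed.
HB.instance Definition _ :=
  GRing.isZmodClosed.Build U central_ideal central_ideal_zmod_closed.

Lemma central_idealMl a x : x \in central_ideal -> a * x \in central_ideal.
Proof.
move=> /asboolP[n [u [c [cm ->]]]]; apply/asboolP.
exists n, (fun i => a * u i), c; split=> //.
by rewrite mulr_sumr; apply: eq_bigr => i _; rewrite mulrA.
Qed.
Lemma central_idealMr a x : x \in central_ideal -> x * a \in central_ideal.
Proof.
move=> /asboolP[n [u [c [cm ->]]]]; apply/asboolP.
exists n, (fun i => u i * a), c; split=> //.
rewrite mulr_suml; apply: eq_bigr => i _; rewrite -!mulrA; congr (_ * _).
by have [+ _] := cm i; apply.
Qed.
HB.instance Definition _ :=
  isTwoSided.Build U central_ideal central_idealMl central_idealMr.

Definition U_lambda : pzRingType := quot_ring central_ideal.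

Lemma central_ideal_kills (a : U) (m : simple_highest_weight) :
  a \in central_ideal -> a *: m = 0.
Proof.
move=> /asboolP[n [u [c [cm ->]]]]; elim/quotW: m => v.
rewrite scaler_suml big1 // => i _; rewrite -scalerA.
rewrite -[\pi v]/(quot_mod_pi _ v) -linearZZ.
by have [_ ->] := cm i; rewrite linear0 scaler0.
Qed.

Definition L_lambda : lmodType U_lambda := descent central_ideal_kills.

End Verma.
End Schrodinger.

(* Main.v *)
(** Put [zeta = lambda(z)] and [mu = lambda(h) + 1/2].  Modulo [z - zeta] the
    elements [e - p^2/(2 zeta)], [h + (pq + qp)/(2 zeta)], [f + q^2/(2 zeta)]
    form an sl2-triple commuting with [p] and [q], whose Casimir element acts on
    the Verma module as on the sl2-Verma module of highest weight [mu].  In a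
    two-sided ideal [I] of [U_lambda], the locally nilpotent [ad p] and [ad q]
    and the diagonalisable [ad h] separate the terms [q^a p^b f^k r(h)] and
    [q^a p^b r(h) e^k] of an element, so [I] is controlled by the polynomials
    [r] with [r(h)] in [I].  With [fe = g(h)], the monic generator [r] of these
    divides [r(X+2) g(X)] and [r(X-2) g(X-2)]; following a root of [r] up and
    down until it meets a root of [g] shows that [r = 1] unless [mu] is an
    integer other than [-1], and that [r] is [1] or the product of the
    [X - (n - 2i)], [0 <= i <= n], when [mu = n >= 0].  In the latter case all
    nonzero proper ideals coincide.  One of them is the annihilator of
    [L(lambda)], and [0] is the annihilator of the simple module generated by
    the singular vector [f^(n+1) v] of the Verma module. *)
Require Import Defs.
From HB Require Import structures.
From mathcomp Require Import all_boot all_order all_algebra ring.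
From mathcomp Require Import boolp functions generic_quotient.
From mathcomp Require Import reals.
From mathcomp Require Import complex.
From Stdlib Require Ncring Ncring_tac.
Set Implicit Arguments.
Unset Strict Implicit.
Unset Printing Implicit Defensive.
Import GRing.Theory Num.Theory.
Local Open Scope ring_scope.

(** * The ideals of polynomials stable under the Casimir relation *)

Section CasimirPolynomials.
Variable K : numClosedFieldType.
Implicit Types (a r : {poly K}) (x mu d : K).

Definition shiftp d a := a \Po ('X + d%:P).

Lemma shiftpM d a b : shiftp d (a * b) = shiftp d a * shiftp d b.
Proof. exact: comp_polyM. Qed.

Lemma shiftpD d a b : shiftp d (a + b) = shiftp d a + shiftp d b.
Proof. exact: comp_polyD. Qed.

Lemma shiftpC d x : shiftp d x%:P = x%:P.
Proof. exact: comp_polyC. Qed.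

Lemma shiftpX d : shiftp d 'X = 'X + d%:P.
Proof. exact: comp_polyX. Qed.

Lemma shiftp0 a : shiftp 0 a = a.
Proof. by rewrite /shiftp addr0 comp_polyXr. Qed.

Lemma shiftp_shiftp d d' a : shiftp d (shiftp d' a) = shiftp (d + d') a.
Proof.
rewrite /shiftp -comp_polyA comp_polyD comp_polyX comp_polyC.
by rewrite polyCD addrA.
Qed.

Lemma horner_shiftp d a x : (shiftp d a).[x] = a.[x + d].
Proof. by rewrite horner_comp !hornerE. Qed.

Lemma shiftp_eq0 d a : (shiftp d a == 0) = (a == 0).
Proof.
apply/eqP/eqP => [E|->]; last exact: comp_poly0.
by rewrite -[a]shiftp0 -(addNr d) -shiftp_shiftp E /shiftp comp_poly0.
Qed.

(** Otherwise [x], [x + d], [x + 2 d], ... would all be roots of [r]; they are distinct in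
    characteristic zero, and [size r] of them exceed the degree. *)
Lemma root_progression r (B : pred K) d : d != 0 -> r != 0 ->
  (forall x, root r x -> ~~ B x -> root r (x + d)) ->
  forall x, root r x -> exists i, B (x + d *+ i).
Proof.
move=> d0 r0 step x rx; apply: contrapT => noB.
have rt i : root r (x + d *+ i).
  elim: i => [|i IH]; first by rewrite addr0.
  rewrite mulrSr addrA; apply: step => //; apply/negP => Bi.
  by apply: noB; exists i.
pose s := [seq x + d *+ i | i <- iota 0 (size r)].
have us : uniq s.
  rewrite map_inj_uniq ?iota_uniq // => i j /addrI.
  rewrite -(mulr_natr _ i) -(mulr_natr _ j) => /(mulfI d0) /eqP.
  by rewrite eqr_nat => /eqP.
have rs : all (root r) s by apply/allP => _ /mapP[i _ ->].
by have := max_poly_roots r0 rs us; rewrite size_map size_iota ltnn.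
Qed.

(* [f e = casimir_poly mu (h)] once the Casimir element acts as on the Verma
   module of highest weight [mu]. *)
Definition casimir_poly mu : {poly K} :=
  - (1 / 4) *: (('X - mu%:P) * ('X + (mu + 2)%:P)).

Lemma root_casimir_poly mu x :
  root (casimir_poly mu) x = (x == mu) || (x == - (mu + 2)).
Proof.
rewrite rootZ ?oppr_eq0 ?div1r ?invr_eq0 ?pnatr_eq0 //.
by rewrite rootM root_XsubC -[_%:P]opprK -polyCN root_XsubC.
Qed.

Lemma casimir_poly_shift mu :
  shiftp (- 2) (casimir_poly mu) = casimir_poly mu + 'X.
Proof.
rewrite /casimir_poly -!mul_polyC shiftpM shiftpC shiftpM -(polyCN mu) !shiftpD.
rewrite shiftpX !shiftpC.
have XE : 'X = (- (1 / 4))%:P * ((- 4)%:P * 'X) :> {poly K}.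
  by rewrite mulrA -polyCM (_ : - (1 / 4) * - 4 = 1 :> K) ?mul1r //; field.
by rewrite [X in _ = _ + X]XE -mulrDr; congr (_ * _); ring.
Qed.

Definition step_stable mu r :=
  (r %| shiftp 2 r * casimir_poly mu) &&
  (r %| shiftp (- 2) (r * casimir_poly mu)).

(** Climbing from [x] in steps of 2 can stop only at a root of [casimir_poly mu], and descending
    only at a point whose lower neighbour is such a root. The two ends use the two different roots
    [mu] and [- (mu + 2)], so the number of steps determines [mu]. *)
Lemma root_step_stable mu r x : r != 0 -> step_stable mu r -> root r x ->
  exists i j : nat,
    mu = (i + j)%:R /\ x = mu - 2 *+ i \/
    mu = - (i + j + 2)%:R /\ x = - (mu + 2) - 2 *+ i.
Proof.
move=> r0 /andP[up down] rx.
have two0 : 2 != 0 :> K by rewrite pnatr_eq0.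
have [i Bi] : exists i, root (casimir_poly mu) (x + 2 *+ i).
  apply: root_progression rx => // y ry nBy.
  have := root_dvdp up ry.
  by rewrite rootM (negPf nBy) orbF /root horner_shiftp.
have [j Bj] : exists j, root (shiftp (-2) (casimir_poly mu)) (x + (-2) *+ j).
  apply: root_progression rx => // [|y ry nBy]; first by rewrite oppr_eq0.
  have := root_dvdp down ry.
  by rewrite shiftpM rootM (negPf nBy) orbF /root horner_shiftp.
move: Bi Bj; rewrite [root (shiftp _ _) _]/root horner_shiftp.
rewrite -[_ == 0]/(root _ _) !root_casimir_poly.
have E k : (k%:R == 0 :> K) = (k == 0)%N by rewrite pnatr_eq0.
have E2 k : 2 *+ k = 2 * k%:R :> K by rewrite mulr_natr.
(* The value reached by climbing lies strictly above the one reached by descending, so they cannot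
   be the same root. *)
have absurd k l : x + 2 *+ k = x - 2 *+ l - 2 -> False.
  move=> H; suff : (2 * (k + l + 1))%:R == 0 :> K.
    by rewrite E muln_eq0 !addn_eq0 andbF.
  rewrite natrM !natrD; apply/eqP; move: H => /eqP.
  rewrite -subr_eq0 => /eqP <-.
  by rewrite !E2; ring.
have half k : 2 * k = 0 :> K -> k = 0.
  by move=> /eqP; rewrite mulf_eq0 (negPf two0) => /eqP.
rewrite mulNrn; exists i, j.
case/orP: Bi => /eqP xi; case/orP: Bj => /eqP xj.
- by case: (absurd i j); rewrite xi xj.
- left; split; last by rewrite -xi addrK.
  apply/eqP; rewrite -subr_eq0; apply/eqP/half.
  move: xi xj => /(canRL (addrK _)) ->; rewrite !E2 natrD => xj.
  transitivity (mu - 2 * i%:R - 2 * j%:R - 2 + (mu + 2)); first by ring.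
  by rewrite xj; ring.
- right; split; last by rewrite -xi addrK.
  apply/eqP; rewrite -subr_eq0; apply/eqP/half.
  move: xi xj => /(canRL (addrK _)) ->; rewrite !E2 !natrD => xj.
  transitivity (mu - (- (mu + 2) - 2 * i%:R - 2 * j%:R - 2)); first by ring.
  by rewrite xj; ring.
- by case: (absurd i j); rewrite xi xj.
Qed.

(** * Weights of the simple sl2-module of highest weight [n] *)

Variable n : nat.

(** The indices [i <= n] give the weights of the simple sl2-module of dimension [n.+1]; the index
    [n.+1] gives the weight of the singular vector. *)
Definition weightn (i : nat) : K := n%:R - 2 *+ i.

Lemma weightn0 : weightn 0 = n%:R.
Proof. by rewrite /weightn mulr0n subr0. Qed.

Lemma weightnS i : weightn i.+1 = weightn i - 2.
Proof. by rewrite /weightn mulrS; ring. Qed.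

Lemma weightn_last : weightn n.+1 = - (n%:R + 2).
Proof. by rewrite /weightn -mulr_natr; ring. Qed.

Lemma weightnD i k : weightn i + (- 2) *+ k = weightn (i + k).
Proof. by rewrite /weightn mulNrn mulrnDr opprD addrA. Qed.

Lemma weightn_inj : injective weightn.
Proof.
move=> i j /addrI /oppr_inj /eqP.
by rewrite -!mulrnA eqr_nat !mul2n => /eqP /double_inj.
Qed.

Definition weight_poly : {poly K} := \prod_(i < n.+1) ('X - (weightn i)%:P).

Lemma root_weight_poly x :
  reflect (exists2 i, (i <= n)%N & x = weightn i) (root weight_poly x).
Proof.
rewrite /weight_poly -(big_mkord xpredT (fun i => 'X - (weightn i)%:P)).
rewrite -(big_map weightn xpredT (fun y => 'X - y%:P)) root_prod_XsubC.
by apply: (iffP mapP) => -[j]; rewrite ?mem_index_iota; exists j;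
  rewrite ?mem_index_iota.
Qed.

Lemma weight_poly_dvd a :
  (forall i, (i <= n)%N -> root a (weightn i)) -> weight_poly %| a.
Proof.
move=> ra; rewrite /weight_poly.
rewrite -(big_mkord xpredT (fun i => 'X - (weightn i)%:P)).
rewrite -(big_map weightn xpredT (fun y => 'X - y%:P)).
apply: uniq_roots_dvdp; last first.
  by rewrite uniq_rootsE map_inj_uniq ?iota_uniq //; exact: weightn_inj.
by apply/allP => _ /mapP[i lein ->]; rewrite mem_index_iota in lein; exact: ra.
Qed.

Lemma weight_poly_neq0 : weight_poly != 0.
Proof. by apply/prodf_neq0 => i _; rewrite polyXsubC_eq0. Qed.

(** The shift moves every root one step down, so both sides are the product over the weights of
    index 0 to [n.+1]. *)
Lemma weight_poly_shift : shiftp 2 weight_poly * ('X - (n%:R)%:P) =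
  weight_poly * ('X + (n%:R + 2)%:P).
Proof.
have -> : shiftp 2 weight_poly = \prod_(i < n.+1) ('X - (weightn i.+1)%:P).
  rewrite /shiftp rmorph_prod; apply: eq_bigr => i _ /=.
  rewrite rmorphB /= comp_polyX comp_polyC weightnS.
  by rewrite (polyCB (weightn i)) opprB addrA addrAC.
rewrite big_ord_recr /= /weight_poly big_ord_recl /= weightn0 weightn_last.
rewrite polyCN opprK; ring.
Qed.

(** [root_step_stable] confines the roots of [r] to the weights, and stability spreads one root to
    all of them. They are simple because the cofactor of [weight_poly] inherits a stability that
    would carry any root of it upwards forever. *)
Lemma step_stable_weight_poly r : r != 0 -> size r != 1 ->
  step_stable n%:R r -> (r %| weight_poly) && (weight_poly %| r).
Proof.
move=> r0 r1 rs.
have rootsE x : root r x -> exists2 i, (i <= n)%N & x = weightn i.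
  move=> /(root_step_stable r0 rs) [i [j [[nij ->]|[nij _]]]].
    exists i => //; move/eqP: nij; rewrite eqr_nat => /eqP ->.
    exact: leq_addr.
  have : (n + (i + j + 2))%:R == 0 :> K.
    by rewrite natrD nij addNr.
  by rewrite pnatr_eq0 !addn_eq0 /= !andbF.
have /andP[up down] := rs.
have Rr : weight_poly %| r.
  have upw i : (i.+1 <= n)%N -> root r (weightn i.+1) -> root r (weightn i).
    move=> lein ri; have := root_dvdp up ri.
    rewrite rootM root_casimir_poly /root horner_shiftp => /or3P[|/eqP|/eqP].
    - by rewrite weightnS subrK.
    - by rewrite -weightn0 => /weightn_inj.
    - by rewrite -weightn_last => /weightn_inj[ni]; rewrite ni ltnn in lein.
  have downw i : (i < n)%N -> root r (weightn i) -> root r (weightn i.+1).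
    move=> lein ri; have := root_dvdp down ri.
    rewrite shiftpM rootM /root !horner_shiftp -weightnS => /orP[//|].
    rewrite -[_ == 0]/(root _ _) root_casimir_poly => /orP[] /eqP.
    - by rewrite -weightn0 => /weightn_inj.
    - by rewrite -weightn_last => /weightn_inj[ni]; rewrite ni ltnn in lein.
  (* From any one root, climb to [weightn 0], then descend through all the weights. *)
  have [x rx] := closed_rootP _ r1.
  have [i0 lei0 xE] := rootsE _ rx; rewrite {}xE in rx.
  have r_0 : root r (weightn 0).
    elim: i0 lei0 rx => // i IH lei /(upw _ lei); apply: IH; exact: ltnW.
  apply: weight_poly_dvd; elim=> // i IH lei; apply: downw => //.
  exact/IH/ltnW.
rewrite Rr andbT.
have /dvdpP[s rE] := Rr.
suff /size_poly1P[c c0 sE] : size s == 1.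
  by rewrite rE sE mul_polyC dvdpZl.
have s0 : s != 0 by apply: contraNneq r0 => s0; rewrite rE s0 mul0r.
apply: contraT => s1; have [x sx] := closed_rootP _ s1.
(* With an empty set of stopping points, the conclusion of [root_progression] is absurd. *)
have Bs : exists i, pred0 (x + 2 *+ i); last by case: Bs.
apply: root_progression sx => // [|y sy _]; first by rewrite pnatr_eq0.
have : s %| ('X + (n%:R + 2)%:P) ^+ 2 * shiftp 2 s.
  rewrite -(dvdp_mul2r _ _ weight_poly_neq0) -rE.
  apply: dvdp_trans up _; rewrite rE shiftpM /casimir_poly -scalerAr.
  rewrite dvdpZl ?oppr_eq0 ?div1r ?invr_eq0 ?pnatr_eq0 //.
  rewrite mulrA -(mulrA _ (shiftp 2 weight_poly)) weight_poly_shift.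
  by rewrite [X in _ %| X](_ : _ = shiftp 2 s * (weight_poly * ('X + (n%:R + 2)%:P)) *
    ('X + (n%:R + 2)%:P)) //; ring.
move=> /root_dvdp /(_ sy); rewrite rootM => /orP[|]; last first.
  by rewrite /root horner_shiftp.
(* The climb could stop only at [- (n + 2)], which is not a weight of index at most [n]. *)
rewrite /root !hornerE expf_eq0 /= => /eqP yE.
have [i lein yE'] : exists2 i, (i <= n)%N & y = weightn i.
  by apply: rootsE; rewrite rE rootM sy.
suff /eqP : (2 * (n - i + 1))%:R = 0 :> K by rewrite pnatr_eq0 muln_eq0 addn_eq0 andbF.
rewrite -yE yE' /weightn natrM natrD natrB // -mulr_natr; ring.
Qed.

(* [e ^+ k * f ^+ k] as a polynomial in [h]. *)
Definition casimir_prod mu k : {poly K} :=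
  \prod_(j < k) shiftp (- 2 *+ j.+1) (casimir_poly mu).

Lemma casimir_prod_neq0 mu k : casimir_prod mu k != 0.
Proof.
apply/prodf_neq0 => j _; rewrite shiftp_eq0 scaler_eq0 mulf_eq0.
rewrite polyXsubC_eq0 oppr_eq0 div1r invr_eq0 pnatr_eq0 /=.
by rewrite -[(mu + 2)%:P]opprK -polyCN polyXsubC_eq0.
Qed.

(** By Bezout it suffices that the gcd of the two polynomials divides [a]. The gcd has simple roots
    [weightn i] with [i + k <= n], whereas the weights at which [casimir_prod] vanishes have
    [i + l = n] for some [l < k]; hence [a] itself vanishes at every root of the gcd. *)
Lemma weight_poly_combination a k :
  weight_poly %| a * casimir_prod n%:R k ->
  exists u v, a = u * weight_poly + v * shiftp (- 2 *+ k) weight_poly.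
Proof.
move=> Ra; set R' := shiftp _ _.
suff : gcdp weight_poly R' %| a.
  have [[u v] /= /andP[d1 _]] := Bezoutp weight_poly R'.
  move=> /(dvdp_trans d1) /dvdpP[c ->].
  by exists (c * u), (c * v); rewrite mulrDr !mulrA.
have [m dE] : {m | gcdp weight_poly R' %= \prod_(i <- mask m (enum 'I_n.+1))
    ('X - (weightn i)%:P)}.
  have := dvdp_gcdl weight_poly R'.
  rewrite /weight_poly -big_enum; exact: dvdp_prod_XsubC.
rewrite (eqp_dvdl _ dE).
rewrite -(big_map (fun i : 'I__ => weightn i) xpredT (fun y => 'X - y%:P)).
apply: uniq_roots_dvdp; last first.
  rewrite uniq_rootsE map_inj_uniq ?mask_uniq ?enum_uniq //.
  by move=> i j /weightn_inj /val_inj.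
apply/allP => x xm.
have : root (gcdp weight_poly R') x.
  rewrite (eqp_root dE).
  rewrite -(big_map (fun i : 'I__ => weightn i) xpredT (fun y => 'X - y%:P)).
  by rewrite root_prod_XsubC.
rewrite root_gcd => /andP[rx]; rewrite /root horner_shiftp.
rewrite -[_ == 0]/(root _ _) => /root_weight_poly[j lejn xE].
have := root_dvdp Ra rx; rewrite rootM => /orP[//|].
rewrite {1}/root horner_prod => /prodf_eq0[l _].
rewrite horner_shiftp => gl0.
have {gl0} : root (casimir_poly n%:R) (x + -2 *+ l.+1) by [].
rewrite root_casimir_poly.
have [i lein xE'] := root_weight_poly _ rx.
rewrite xE' weightnD => /orP[] /eqP.
  by rewrite -weightn0 => /weightn_inj /eqP; rewrite addn_eq0 andbF.
rewrite -weightn_last => /weightn_inj; rewrite addnS => -[E2].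
move: xE; rewrite xE' weightnD => /weightn_inj E1.
have : (i + l < i + k)%N by rewrite ltn_add2l.
by rewrite E1 E2 ltnNge lejn.
Qed.

End CasimirPolynomials.

(** * Two-sided ideals of the Weyl algebra tensored with a central quotient of U(sl2) *)

Section IdealPredicates.
Variable A : pzRingType.

(** A [Prop]-valued counterpart of [twoSidedIdeal], under which annihilators and the zero ideal can
    be compared directly. *)
Record ideal (I : A -> Prop) : Prop := Ideal {
  ideal0 : I 0;
  idealD : forall x y, I x -> I y -> I (x + y);
  ideal_mull : forall a x, I x -> I (a * x);
  ideal_mulr : forall a x, I x -> I (x * a)
}.

Variables (I : A -> Prop) (idI : ideal I).

Lemma idealN x : I x -> I (- x).
Proof. by rewrite -mulN1r; apply: ideal_mull. Qed.

Lemma idealB x y : I x -> I y -> I (x - y).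
Proof. by move=> Ix Iy; apply: idealD => //; apply: idealN. Qed.

Lemma ideal_sum (T : eqType) (s : seq T) (P : pred T) (F : T -> A) :
  (forall t, t \in s -> P t -> I (F t)) -> I (\sum_(t <- s | P t) F t).
Proof.
move=> IF; rewrite big_seq_cond; apply: big_ind => [|x y|t /andP[]].
- exact: ideal0.
- exact: idealD.
- exact: IF.
Qed.

End IdealPredicates.

(** * Normal forms and separation of monomials *)

Section WeylTensorSl2.
Variables (K : numClosedFieldType) (A : pzRingType).
Variables (ev : {rmorphism {poly K} -> A}) (e f p q : A) (zeta mu : K).
Local Notation cst c := (ev c%:P).
Local Notation h := (ev 'X).

(** Relations and generation only: the normally ordered monomials are not assumed independent. As
    [A] is a bare ring, its scalars are the constants [cst c], and [weyl_sl2_ind] says that the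
    generators and these scalars generate [A]. *)
Record weyl_sl2 : Prop := WeylSl2 {
  cstC : forall c x, cst c * x = x * cst c;
  zeta_neq0 : zeta != 0;
  pqE : p * q = q * p + cst zeta;
  peC : p * e = e * p;
  phC : p * h = h * p;
  pfC : p * f = f * p;
  qeC : q * e = e * q;
  qhC : q * h = h * q;
  qfC : q * f = f * q;
  ehE : e * h = (h - cst 2) * e;
  fhE : f * h = (h + cst 2) * f;
  feE : f * e = ev (casimir_poly mu);
  efE : e * f = ev (shiftp (- 2) (casimir_poly mu));
  weyl_sl2_ind : forall P : A -> Prop, P 1 ->
    (forall x y, P x -> P y -> P (x + y)) ->
    (forall c x, P x -> P (cst c * x)) ->
    (forall x, P x -> P (e * x)) -> (forall x, P x -> P (h * x)) ->
    (forall x, P x -> P (f * x)) -> (forall x, P x -> P (p * x)) ->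
    (forall x, P x -> P (q * x)) -> forall x, P x
}.

Hypothesis W : weyl_sl2.

Lemma cst_unit c x : c != 0 -> cst c^-1 * (cst c * x) = x.
Proof. by move=> c0; rewrite mulrA -rmorphM -polyCM mulVf // rmorph1 mul1r. Qed.

Lemma ev_shift d y : y * h = (h + cst d) * y ->
  forall a, y * ev a = ev (shiftp d a) * y.
Proof.
move=> yh; elim/poly_ind => [|a c IH].
  by rewrite /shiftp comp_poly0 rmorph0 mulr0 mul0r.
rewrite shiftpD shiftpM shiftpX shiftpC !rmorphD !rmorphM mulrDr mulrA IH.
rewrite -(mulrA (ev (shiftp d a))) yh rmorphD -(cstC W c y).
by rewrite [RHS]mulrDl mulrA.
Qed.

Lemma e_ev a : e * ev a = ev (shiftp (- 2) a) * e.
Proof. by apply: ev_shift; rewrite (ehE W) polyCN rmorphN. Qed.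

Lemma f_ev a : f * ev a = ev (shiftp 2 a) * f.
Proof. exact/ev_shift/(fhE W). Qed.

Lemma ev_f a : ev a * f = f * ev (shiftp (- 2) a).
Proof. by rewrite f_ev shiftp_shiftp subrr shiftp0. Qed.

Lemma p_ev a : p * ev a = ev a * p.
Proof. by rewrite (@ev_shift 0) ?shiftp0 // rmorph0 addr0 (phC W). Qed.

Lemma q_ev a : q * ev a = ev a * q.
Proof. by rewrite (@ev_shift 0) ?shiftp0 // rmorph0 addr0 (qhC W). Qed.

Lemma e_exp_ev k a : e ^+ k * ev a = ev (shiftp (- 2 *+ k) a) * e ^+ k.
Proof.
elim: k a => [|k IH] a; first by rewrite !expr0 mulr0n shiftp0 mul1r mulr1.
by rewrite exprSr -mulrA e_ev mulrA IH shiftp_shiftp -mulrSr -mulrA.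
Qed.

Lemma ev_f_exp k a : ev a * f ^+ k = f ^+ k * ev (shiftp (- 2 *+ k) a).
Proof.
elim: k a => [|k IH] a; first by rewrite !expr0 mulr0n shiftp0 mul1r mulr1.
by rewrite exprS mulrA ev_f -mulrA IH shiftp_shiftp -mulrSr !mulrA.
Qed.

Lemma ef_exp k : e ^+ k * f ^+ k = ev (casimir_prod mu k).
Proof.
rewrite /casimir_prod; elim: k => [|k IH].
  by rewrite !expr0 big_ord0 rmorph1 mulr1.
rewrite exprSr exprS -mulrA (mulrA e) (efE W) mulrA e_exp_ev -mulrA IH.
by rewrite -rmorphM shiftp_shiftp -mulrSr big_ord_recr mulrC.
Qed.

(* [sl2_mon m a] has weight [- 2 m] for the adjoint action of [h]. *)
Definition sl2_mon (m : int) a : A :=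
  match m with
  | Posz k => f ^+ k * ev a
  | Negz k => ev a * e ^+ k.+1
  end.

Lemma sl2_monD m a b : sl2_mon m (a + b) = sl2_mon m a + sl2_mon m b.
Proof. by case: m => k; rewrite /= rmorphD (mulrDl, mulrDr). Qed.

Lemma sl2_mon0 m : sl2_mon m 0 = 0.
Proof. by case: m => k; rewrite /= rmorph0 (mul0r, mulr0). Qed.

Lemma sl2_mon_sum m (T : Type) (s : seq T) (P : pred T) (F : T -> {poly K}) :
  sl2_mon m (\sum_(t <- s | P t) F t) = \sum_(t <- s | P t) sl2_mon m (F t).
Proof.
by apply: (big_morph (sl2_mon m)); [exact: sl2_monD|exact: sl2_mon0].
Qed.

Lemma h_sl2_mon m a : h * sl2_mon m a - sl2_mon m a * h =
  cst (- 2 * m%:~R) * sl2_mon m a.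
Proof.
have twok k : - 2 * k%:R = - 2 *+ k :> K by rewrite mulr_natr.
case: m => k /=.
  rewrite mulrA ev_f_exp shiftpX -mulrA -rmorphM -[f ^+ k * ev a * h]mulrA.
  rewrite -rmorphM -mulrBr -rmorphB (mulrC a) mulrDl addrAC subrr add0r.
  by rewrite rmorphM mulrA -(cstC W) -mulrA twok.
rewrite NegzE rmorphN /= -[ev a * _ * h]mulrA e_exp_ev shiftpX.
rewrite !mulrA -!rmorphM -mulrBl -rmorphB (mulrC a) -mulrBl opprD addrA.
by rewrite subrr add0r -polyCN mulrN twok.
Qed.

Lemma e_sl2_mon m a : exists m' a', e * sl2_mon m a = sl2_mon m' a'.
Proof.
case: m => [[|k]|k] /=.
- by exists (Negz 0), (shiftp (- 2) a); rewrite expr0 mul1r e_ev.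
- exists (Posz k), (shiftp (- 2 *+ k) (shiftp (- 2) (casimir_poly mu)) * a).
  by rewrite exprS !mulrA (efE W) ev_f_exp /= rmorphM mulrA.
- exists (Negz k.+1), (shiftp (- 2) a).
  by rewrite mulrA e_ev -mulrA -exprS.
Qed.

Lemma f_sl2_mon m a : exists m' a', f * sl2_mon m a = sl2_mon m' a'.
Proof.
have E k : f * (ev a * e ^+ k.+1) = ev (shiftp 2 a * casimir_poly mu) * e ^+ k.
  by rewrite exprS !mulrA f_ev -(mulrA _ f) (feE W) rmorphM.
case: m => [k|[|k]] /=; rewrite ?E.
- by exists (Posz k.+1), a; rewrite /= exprS mulrA.
- by exists (Posz 0), (shiftp 2 a * casimir_poly mu); rewrite /= expr0 mul1r mulr1.
- by exists (Negz k), (shiftp 2 a * casimir_poly mu).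
Qed.

Lemma ev_sl2_mon b m a : exists a', ev b * sl2_mon m a = sl2_mon m a'.
Proof.
case: m => k /=.
  by exists (shiftp (- 2 *+ k) b * a); rewrite mulrA ev_f_exp rmorphM mulrA.
by exists (b * a); rewrite rmorphM mulrA.
Qed.

Lemma p_sl2_mon m a : p * sl2_mon m a = sl2_mon m a * p.
Proof.
have pX y k : p * y = y * p -> p * y ^+ k = y ^+ k * p.
  by move=> py; elim: k => [|k IH];
    rewrite ?expr0 ?mulr1 ?mul1r // exprS mulrA py -mulrA IH mulrA.
case: m => k /=.
  by rewrite mulrA pX ?(pfC W) // -mulrA p_ev mulrA.
by rewrite mulrA p_ev -mulrA pX ?(peC W) // mulrA.
Qed.

Lemma q_sl2_mon m a : q * sl2_mon m a = sl2_mon m a * q.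
Proof.
have qX y k : q * y = y * q -> q * y ^+ k = y ^+ k * q.
  by move=> py; elim: k => [|k IH];
    rewrite ?expr0 ?mulr1 ?mul1r // exprS mulrA py -mulrA IH mulrA.
case: m => k /=.
  by rewrite mulrA qX ?(qfC W) // -mulrA q_ev mulrA.
by rewrite mulrA q_ev -mulrA qX ?(qeC W) // mulrA.
Qed.

Definition monomial (t : nat * nat * (int * {poly K})) : A :=
  q ^+ t.1.1 * (p ^+ t.1.2 * sl2_mon t.2.1 t.2.2).

Lemma comm_exp_q y a : q * y = y * q -> y * q ^+ a = q ^+ a * y.
Proof.
by move=> qy; elim: a => [|a IH];
  rewrite ?expr0 ?mulr1 ?mul1r // exprSr mulrA IH -!mulrA qy.
Qed.

Lemma comm_exp_p y b : p * y = y * p -> y * p ^+ b = p ^+ b * y.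
Proof.
by move=> qy; elim: b => [|a IH];
  rewrite ?expr0 ?mulr1 ?mul1r // exprSr mulrA IH -!mulrA qy.
Qed.

(* [x] acts on [y ^+ a] as a derivation sending [y] to the constant [c]. *)
Lemma ad_exp x y c a : x * y = y * x + cst c ->
  x * y ^+ a = y ^+ a * x + cst (c * a%:R) * y ^+ a.-1.
Proof.
move=> xy; elim: a => [|a IH].
  by rewrite !expr0 mulr0 polyC0 rmorph0 mul0r addr0 mulr1 mul1r.
rewrite exprS mulrA xy mulrDl -mulrA IH mulrDr mulrA -exprS -addrA.
congr (_ + _); rewrite mulrA -(cstC W) -mulrA.
case: a {IH} => [|a] /=.
  by rewrite mulr0 polyC0 rmorph0 mul0r add0r expr0 !mulr1.
by rewrite -exprS -mulrDl -rmorphD -polyCD -[a.+2%:R]natr1 mulrDr mulr1.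
Qed.

Lemma p_exp_q a : p * q ^+ a = q ^+ a * p + cst (zeta * a%:R) * q ^+ a.-1.
Proof. exact/ad_exp/(pqE W). Qed.

(** The span of the monomials contains 1 and is stable under left multiplication by each generator.
    The sl2 part passes through [p] and [q] and sends one [sl2_mon] to another; only [p] must be
    reordered, past [q ^+ a]. *)
Lemma monomial_spanning x : exists s, x = \sum_(t <- s) monomial t.
Proof.
pose spanned x := exists s, x = \sum_(t <- s) monomial t.
have spannedM y : (forall t, spanned (y * monomial t)) ->
    forall x, spanned x -> spanned (y * x).
  move=> ym _ [s ->]; elim: s => [|t s [s' IH]].
    by exists [::]; rewrite !big_nil mulr0.
  have [t' mt] := ym t; exists (t' ++ s').
  by rewrite big_cons big_cat mulrDr mt IH.
have commM y m' a' t : q * y = y * q -> p * y = y * p ->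
    y * sl2_mon t.2.1 t.2.2 = sl2_mon m' a' -> spanned (y * monomial t).
  move=> qy py my; exists [:: (t.1, (m', a'))]; rewrite big_seq1 /monomial /= -my.
  rewrite mulrA comm_exp_q // -!mulrA; congr (_ * _).
  by rewrite !mulrA comm_exp_p.
rewrite -/(spanned x); move: x; apply: (weyl_sl2_ind W).
- exists [:: ((0%N, 0%N), (Posz 0, 1))]; rewrite big_seq1 /monomial /=.
  by rewrite !expr0 rmorph1 !mul1r.
- by move=> _ _ [s ->] [t ->]; exists (s ++ t); rewrite big_cat.
- move=> c; apply: spannedM => t.
  have [a ma] := ev_sl2_mon c%:P t.2.1 t.2.2.
  by apply: commM ma; rewrite (cstC W).
- apply: spannedM => t.
  have [m [a ma]] := e_sl2_mon t.2.1 t.2.2.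
  by apply: commM ma; rewrite ?(qeC W) ?(peC W).
- apply: spannedM => t.
  have [a ma] := ev_sl2_mon 'X t.2.1 t.2.2.
  by apply: commM ma; rewrite ?(qhC W) ?(phC W).
- apply: spannedM => t.
  have [m [a ma]] := f_sl2_mon t.2.1 t.2.2.
  by apply: commM ma; rewrite ?(qfC W) ?(pfC W).
- apply: spannedM => t.
  have [a ma] := ev_sl2_mon (zeta * t.1.1%:R)%:P t.2.1 t.2.2.
  (* The second monomial is the commutator of [p] with the power of [q]; its coefficient vanishes
     when that power is 0, where [.-1] truncates. *)
  exists [:: ((t.1.1, t.1.2.+1), t.2); ((t.1.1.-1, t.1.2), (t.2.1, a))].
  rewrite !big_cons big_nil addr0 /monomial /= -ma mulrA p_exp_q mulrDl exprS.
  rewrite -!mulrA; congr (_ + _).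
  by rewrite (cstC W) -!mulrA -(cstC W).
- apply: spannedM => t; exists [:: ((t.1.1.+1, t.1.2), t.2)].
  by rewrite big_seq1 /monomial /= mulrA -exprS.
Qed.


(** The commutator with [x] acts as [c] times differentiation in [y], so it turns the sum into a
    shorter one with coefficients [c (a + 1) z (a + 1)]. Induction puts these in [I], and
    subtraction then yields [z 0]. *)
Lemma ideal_ad_nilpotent I x y c N (z : nat -> A) :
  ideal I -> c != 0 -> x * y = y * x + cst c ->
  (forall a, x * z a = z a * x) ->
  I (\sum_(0 <= a < N) y ^+ a * z a) -> forall a, (a < N)%N -> I (z a).
Proof.
move=> idI c0 xy; elim: N z => // N IH z xz Is.
have Iz a : (a < N)%N -> I (z a.+1).
  move=> aN; rewrite -(@cst_unit (c * a.+1%:R) (z a.+1)) ?mulf_neq0 ?pnatr_eq0 //.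
  apply: ideal_mull => //.
  apply: (IH (fun a => cst (c * a.+1%:R) * z a.+1)) aN.
    by move=> b; rewrite mulrA -(cstC W) -!mulrA xz.
  rewrite (_ : \sum_(_ <= _ < _) _ = x * \sum_(0 <= a < N.+1) y ^+ a * z a -
      \sum_(0 <= a < N.+1) y ^+ a * z a * x).
    by apply: idealB => //; [exact: ideal_mull | rewrite -mulr_suml; exact: ideal_mulr].
  rewrite mulr_sumr -sumrB big_nat_recl //= expr0 !mul1r xz subrr add0r.
  apply: eq_bigr => b _.
  rewrite [x * _]mulrA (ad_exp _ xy) mulrDl -!mulrA xz addrAC subrr add0r /=.
  by rewrite mulrA -(cstC W) -mulrA.
case=> [_|a]; last exact: Iz.
move: Is; rewrite big_nat_recl // expr0 mul1r => Is.
rewrite -[z 0%N](addrK (\sum_(0 <= i < N) y ^+ i.+1 * z i.+1)).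
apply: idealB => //; apply: ideal_sum => // b; rewrite mem_index_iota => bN _.
by apply: ideal_mull => //; apply: Iz.
Qed.

(** Subtracting the eigenvalue of [m0] from [ad h] kills the first term and multiplies every other
    term by a nonzero scalar; induct on the number of terms. *)
Lemma ideal_ad_diagonal I s (y : int -> A) :
  ideal I -> uniq s ->
  (forall m, h * y m - y m * h = cst (- 2 * m%:~R) * y m) ->
  I (\sum_(m <- s) y m) -> forall m, m \in s -> I (y m).
Proof.
move=> idI; elim: s y => // m0 s IH y /= /andP[m0s us] hy Is.
have Iy m : m \in s -> I (y m).
  move=> ms; pose d m : K := - 2 * m%:~R - (- 2 * m0%:~R).
  have dm : d m != 0.
    rewrite /d -mulrBr mulf_eq0 oppr_eq0 pnatr_eq0 subr_eq0 eqr_int /=.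
    by apply: contraNneq m0s => <-.
  rewrite -(cst_unit (y m) dm); apply: ideal_mull => //.
  apply: (IH (fun m => cst (d m) * y m)) ms => //.
    move=> m'; rewrite mulrA -(cstC W) -!mulrA -mulrBr hy.
    by rewrite !mulrA; congr (_ * _); rewrite -!rmorphM mulrC.
  rewrite (_ : \sum_(m <- s) _ = (h * \sum_(m <- m0 :: s) y m -
      \sum_(m <- m0 :: s) y m * h) - cst (- 2 * m0%:~R) * \sum_(m <- m0 :: s) y m).
    apply: idealB => //; last exact: ideal_mull.
    by apply: idealB => //; [exact: ideal_mull | rewrite -mulr_suml; exact: ideal_mulr].
  rewrite !mulr_sumr -!sumrB big_cons hy subrr add0r.
  by apply: eq_bigr => m' _; rewrite hy -mulrBl -rmorphB -polyCB.
move=> m; rewrite inE => /predU1P[->|]; last exact: Iy.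
move: Is; rewrite big_cons => Is.
rewrite -[y m0](addrK (\sum_(i <- s) y i)).
by apply: idealB => //; apply: ideal_sum => // b bs _; apply: Iy.
Qed.

Lemma big_group (T J : eqType) (k : T -> J) (r : seq J) (s : seq T)
    (P : pred T) (F : T -> A) :
  uniq r -> {subset map k s <= r} ->
  \sum_(t <- s | P t) F t = \sum_(j <- r) \sum_(t <- s | P t && (k t == j)) F t.
Proof.
move=> ur sr; rewrite (exchange_big_dep P) /=; last by move=> ? ? _ /andP[].
rewrite big_seq_cond [RHS]big_seq_cond; apply: eq_bigr => t /andP[ts Pt].
rewrite Pt big_mkcond (bigD1_seq (k t)) ?eqxx //=; last exact/sr/map_f.
by rewrite big1 ?addr0 // => j /negPf jt; rewrite eq_sym jt.
Qed.

(** [ad p] separates the powers of [q], then [ad q] those of [p], then [ad h] the weights. So every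
    [sl2_mon] component of an element of [I] lies in [I], hence in [J], and the element is rebuilt
    inside [J]. *)
Lemma ideal_incl I J : ideal I -> ideal J ->
  (forall m a, I (sl2_mon m a) -> J (sl2_mon m a)) -> forall x, I x -> J x.
Proof.
move=> idI idJ IJ x; have [s ->] := monomial_spanning x.
pose N := (\max_(t <- s) maxn t.1.1 t.1.2).+1.
have sN t : t \in s -> (t.1.1 < N)%N && (t.1.2 < N)%N.
  move=> ts; rewrite !ltnS -geq_max.
  exact: (@leq_bigmax_seq _ _ xpredT (fun t => maxn t.1.1 t.1.2)).
pose r := undup [seq t.2.1 | t <- s].
(* The sum is regrouped in three layers: [y a] is the coefficient of [q ^+ a], [z a b] that of
   [p ^+ b] in it, and [u a b m] the polynomial in the part of [z a b] of index [m]. *)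
pose u a b m := \sum_(t <- s | (t.1.1 == a) && (t.1.2 == b) && (t.2.1 == m)) t.2.2.
pose z a b := \sum_(t <- s | (t.1.1 == a) && (t.1.2 == b)) sl2_mon t.2.1 t.2.2.
pose y a := \sum_(t <- s | t.1.1 == a) p ^+ t.1.2 * sl2_mon t.2.1 t.2.2.
have zE a b : z a b = \sum_(m <- r) sl2_mon m (u a b m).
  rewrite /z (big_group (k := fun t => t.2.1) (r := r)) ?undup_uniq //.
    apply: eq_bigr => m _; rewrite sl2_mon_sum.
    by apply: eq_bigr => t /andP[_ /eqP ->].
  by move=> m; rewrite mem_undup.
have yE a : y a = \sum_(0 <= b < N) p ^+ b * z a b.
  rewrite /y (big_group (k := fun t => t.1.2) (r := index_iota 0 N)) ?iota_uniq //.
    by apply: eq_bigr => b _; rewrite mulr_sumr; apply: eq_bigr => t /andP[_ /eqP ->].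
  by move=> b /mapP[t /sN/andP[_ tN] ->]; rewrite mem_index_iota.
have -> : \sum_(t <- s) monomial t = \sum_(0 <= a < N) q ^+ a * y a.
  rewrite (big_group (k := fun t => t.1.1) (r := index_iota 0 N)) ?iota_uniq //.
    by apply: eq_bigr => b _; rewrite mulr_sumr; apply: eq_bigr => t /andP[_ /eqP <-].
  by move=> b /mapP[t /sN/andP[tN _] ->]; rewrite mem_index_iota.
have qpE : q * p = p * q + cst (- zeta).
  by rewrite (pqE W) polyCN rmorphN addrK.
have nz0 : - zeta != 0 by rewrite oppr_eq0 (zeta_neq0 W).
move=> Ix; apply: ideal_sum => // a; rewrite mem_index_iota => aN _.
apply: ideal_mull => //; rewrite yE.
have {Ix} : I (y a).
  apply: (ideal_ad_nilpotent idI (zeta_neq0 W) (pqE W)) Ix _ aN => b.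
  rewrite mulr_sumr mulr_suml; apply: eq_bigr => t _.
  by rewrite mulrA -exprS exprSr -!mulrA p_sl2_mon.
rewrite yE => Iy; apply: ideal_sum => // b; rewrite mem_index_iota => bN _.
apply: ideal_mull => //; rewrite zE.
have {Iy} : I (z a b).
  apply: (ideal_ad_nilpotent idI nz0 qpE) Iy _ bN => c.
  by rewrite mulr_sumr mulr_suml; apply: eq_bigr => t _; rewrite q_sl2_mon.
rewrite zE => Iz; apply: ideal_sum => // m mr _; apply: IJ.
apply: (ideal_ad_diagonal idI (undup_uniq _) _ Iz) mr => {}m.
exact: h_sl2_mon.
Qed.

(** Multiplication by [e ^+ k] on the left, or by [f ^+ k] on the right, brings the monomial to
    weight zero at the cost of the factor [casimir_prod]. *)
Lemma ideal_sl2_mon I m a : ideal I -> I (sl2_mon m a) ->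
  I (ev (a * casimir_prod mu `|m|)).
Proof.
move=> idI; case: m => k /= Im.
  by rewrite mulrC rmorphM -ef_exp -mulrA; apply: ideal_mull.
by rewrite rmorphM -ef_exp mulrA; apply: ideal_mulr.
Qed.

(** The polynomials evaluated into [I] form an ideal of [{poly K}]; [r] is a nonzero element of
    least size in it. *)
Lemma ideal_ev_generator I : ideal I -> (exists2 x : A, I x & x != 0) ->
  exists2 r, r != 0 /\ step_stable mu r & forall b, I (ev b) <-> r %| b.
Proof.
move=> idI [x Ix x0].
have [r r0 Ir] : exists2 r, r != 0 & I (ev r).
  (* If only the zero polynomial occurred, comparison with the zero ideal through [ideal_incl] would
     force [x = 0]. *)
  apply: contrapT => none; case/negP: x0; apply/eqP.
  have id0 : ideal (fun y : A => y = 0).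
    split=> //; first by move=> ? ? -> ->; rewrite addr0.
      by move=> ? ? ->; rewrite mulr0.
    by move=> ? ? ->; rewrite mul0r.
  apply: (ideal_incl idI id0) Ix => m a Ima.
  suff -> : a = 0 by exact: sl2_mon0.
  apply: contrapT => /eqP a0; apply: none.
  exists (a * casimir_prod mu `|m|); last exact: ideal_sl2_mon.
  by rewrite mulf_neq0 ?casimir_prod_neq0.
pose Q k := `[< exists2 r, r != 0 & I (ev r) /\ size r = k >].
have exQ : exists k, Q k by exists (size r); apply/asboolP; exists r.
have [k /asboolP[{Ir}r {}r0 [Ir <-]] min] := ex_minnP exQ.
have Idvd b : I (ev b) <-> r %| b.
  split=> [Ib|/dvdpP[c ->]]; last by rewrite rmorphM; apply: ideal_mull.
  rewrite /dvdp; apply: contraT => br.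
  have := ltn_modp b r; rewrite r0 ltnNge min //; apply/asboolP.
  exists (b %% r) => //; split=> //.
  have -> : b %% r = b - b %/ r * r by rewrite {2}(divp_eq b r) addrAC subrr add0r.
  by rewrite rmorphB rmorphM; apply: idealB => //; apply: ideal_mull.
(* The two divisibilities come from [f r(h) e] and [e r(h) f], both in [I]. *)
exists r => //; split=> //; apply/andP; split; apply/Idvd.
  rewrite rmorphM -(feE W) mulrA -f_ev.
  by apply: ideal_mulr => //; apply: ideal_mull.
rewrite shiftpM rmorphM -(efE W) mulrA -e_ev.
by apply: ideal_mulr => //; apply: ideal_mull.
Qed.

(** If the generator were nonconstant it would have a root, and [root_step_stable] would make [mu]
    an integer at least 0 or at most -2. *)
Lemma ideal_eqT I : ideal I -> (exists2 x : A, I x & x != 0) ->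
  (forall k, mu != k%:R) -> (forall k, mu != - (k.+2)%:R) -> I (1 : A).
Proof.
move=> idI I0 mu1 mu2; have [r [r0 rs] Ir] := ideal_ev_generator idI I0.
rewrite -(rmorph1 ev) Ir dvdp1; apply: contraT => r1.
have [x rx] := closed_rootP _ r1.
have [i [j [[muE _]|[muE _]]]] := root_step_stable r0 rs rx.
  by have := mu1 (i + j)%N; rewrite muE eqxx.
by have := mu2 (i + j)%N; rewrite muE !addnS addn0 eqxx.
Qed.

(** * Ideals when [mu] is a natural number *)

Section Integral.
Variable n : nat.
Hypothesis mun : mu = n%:R.

(** The generator is either a constant or associate to [weight_poly]; it divides [weight_poly] in
    both cases. *)
Lemma ideal_weight_poly I : ideal I -> (exists2 x : A, I x & x != 0) ->
  I (ev (weight_poly K n)).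
Proof.
move=> idI I0; have [r [r0 rs] Ir] := ideal_ev_generator idI I0.
apply/Ir; have [/eqP/size_poly1P[c c0 ->]|r1] := eqVneq (size r) 1%N.
  by rewrite -[c%:P]mulr1 mul_polyC dvdpZl // dvd1p.
by rewrite mun in rs; have /andP[] := step_stable_weight_poly r0 r1 rs.
Qed.

Lemma ideal_weight_poly_dvd I b : ideal I -> (exists2 x : A, I x & x != 0) ->
  ~ I (1 : A) -> I (ev b) -> weight_poly K n %| b.
Proof.
move=> idI I0 I1; have [r [r0 rs] Ir] := ideal_ev_generator idI I0.
move=> /Ir; apply: dvdp_trans.
have r1 : size r != 1%N.
  by apply/negP => r1; apply: I1; rewrite -(rmorph1 ev) Ir dvdp1.
by rewrite mun in rs; have /andP[] := step_stable_weight_poly r0 r1 rs.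
Qed.

(** By [weight_poly_combination], the polynomial of a monomial in [I] is a combination of
    [weight_poly] and its shift. Moving the shifted copy across the power of [e] or [f] undoes the
    shift, so both terms lie in the ideal generated by [ev (weight_poly K n)], hence in [J]. *)
Lemma ideal_nontrivial_incl I J :
  ideal I -> ideal J ->
  (exists2 x : A, I x & x != 0) -> (exists2 x : A, J x & x != 0) ->
  ~ I (1 : A) -> forall x, I x -> J x.
Proof.
move=> idI idJ I0 J0 I1; have JR := ideal_weight_poly idJ J0.
apply: ideal_incl => // m a /(ideal_sl2_mon idI).
rewrite mun => /(ideal_weight_poly_dvd idI I0 I1).
move=> /weight_poly_combination[u [v ->]]; rewrite sl2_monD.
apply: idealD => //; case: m => k /=.
- by rewrite rmorphM mulrA; apply: ideal_mull.
- by rewrite rmorphM -mulrA; apply: ideal_mull => //; apply: ideal_mulr.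
- by rewrite mulrC rmorphM mulrA -ev_f_exp -mulrA; apply: ideal_mulr.
- by rewrite rmorphM -mulrA -e_exp_ev mulrA; apply: ideal_mull.
Qed.

End Integral.

End WeylTensorSl2.

(** * Highest weight modules and their simple quotients *)

Section SimpleModules.
Variable A : pzRingType.
Implicit Types M : lmodType A.

Lemma simple_module_cyclic M (m m' : M) :
  simple_module M -> m != 0 -> exists a, m' = a *: m.
Proof.
move=> [_ simpM] m0.
pose N : {pred M} := fun x => `[< exists a, x = a *: m >].
have Nclosed : submod_closed N.
  split; first by apply/asboolP; exists 0; rewrite scale0r.
  move=> a _ _ /asboolP[b ->] /asboolP[c ->]; apply/asboolP.
  by exists (a * b + c); rewrite scalerDl scalerA.
pose C := GRing.isSubmodClosed.Build A M N (GRing.submod_closed_semi Nclosed).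
pose N' : submodClosed M := HB.pack N C.
have mN : m \in N by apply/asboolP; exists 1; rewrite scale1r.
have [NE|NE] := simpM N'.
  by have := NE m; rewrite [m \in _]mN inE (negPf m0).
by have := NE m'; rewrite inE => /asboolP.
Qed.

Lemma annihilator_ideal M : ideal (fun a => forall m : M, a *: m = 0).
Proof.
split=> [m|a b aM bM m|a b bM m|a b bM m].
- exact: scale0r.
- by rewrite scalerDl aM bM addr0.
- by rewrite -scalerA bM scaler0.
- by rewrite -scalerA bM.
Qed.

Lemma quot_mod_pi_surj M (N : submodClosed M) (x : quot_mod N) :
  exists m, x = quot_mod_pi N m.
Proof. by elim/quotW: x => m; exists m. Qed.

(* The quotient is by the largest submodule contained in the kernel of
   [psi]. *)
Lemma simple_quotient_of_functional M (Y : zmodType) (psi : M -> Y) (v : M) :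
  {morph psi : x y / x + y} -> psi v != 0 ->
  (forall m, exists a, m = a *: v) ->
  (forall m, psi m != 0 ->
     exists t, forall a, psi (a *: (t *: m)) = psi (a *: v)) ->
  exists2 N : submodClosed M, simple_module (quot_mod N) &
    forall m, m \in N <-> forall a, psi (a *: m) = 0.
Proof.
move=> psiD psiv cyc retract.
have psi0 : psi 0 = 0 by apply: (addrI (psi 0)); rewrite -psiD !addr0.
have psiN m : psi (- m) = - psi m.
  by apply: (addrI (psi m)); rewrite -psiD !subrr.
pose N : {pred M} := fun x => `[< forall a, psi (a *: x) = 0 >].
have Nclosed : submod_closed N.
  split; first by apply/asboolP => a; rewrite scaler0.
  move=> a x y /asboolP Nx /asboolP Ny; apply/asboolP => b.
  by rewrite scalerDr psiD scalerA Nx Ny addr0.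
pose C := GRing.isSubmodClosed.Build A M N (GRing.submod_closed_semi Nclosed).
pose N' : submodClosed M := HB.pack N C.
have NE m : m \in N' <-> forall a, psi (a *: m) = 0.
  by split=> [/asboolP|Nm] //; apply/asboolP.
exists N' => //; split.
  exists (quot_mod_pi N' v); rewrite quot_mod_pi_eq0.
  by apply/negP => /NE/(_ 1); rewrite scale1r => /eqP; rewrite (negPf psiv).
move=> Q; have [Q0|Q0] := pselect (forall x, x \in Q -> x = 0); [left|right].
  move=> x; rewrite inE; apply/idP/eqP => [/Q0 //|->].
  exact: rpred0.
have QZ a x : x \in Q -> a *: x \in Q by exact: rpredZ.
have QB x y : x \in Q -> y \in Q -> x - y \in Q.
  by move=> Qx Qy; rewrite rpredD // -scaleN1r QZ.
move/existsNP: Q0 => [x0 /not_implyP[Qx0 x00]].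
have [x x0E] := quot_mod_pi_surj x0; rewrite {x0}x0E in Qx0 x00.
have /existsNP[a psia] : ~ forall a, psi (a *: x) = 0.
  by move/NE; rewrite -quot_mod_pi_eq0 => /eqP.
(* Modulo the submodule, [t] sends [a *: x] to the generator [v], so [Q] contains the image of
   [v]. *)
have [t tE] := retract _ (introN eqP psia).
move=> y; have [{}y ->] := quot_mod_pi_surj y; rewrite inE.
have [b ->] := cyc y.
suff -> : quot_mod_pi N' (b *: v) = (b * t * a) *: quot_mod_pi N' x by apply: QZ.
apply/eqP; rewrite -subr_eq0 -linearZ -linearB quot_mod_pi_eq0; apply/NE => c.
rewrite scalerBr psiD psiN !scalerA.
by have := tE (c * b); rewrite !scalerA !mulrA => ->; rewrite subrr.
Qed.

End SimpleModules.

(** * Vectors of highest weight and their descendants *)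

Section HighestWeight.
Variables (K : numClosedFieldType) (A : pzRingType).
Variables (ev : {rmorphism {poly K} -> A}) (e f p q : A) (zeta mu : K).
Hypothesis W : weyl_sl2 ev e f p q zeta mu.
Local Notation cst c := (ev c%:P).
Local Notation h := (ev 'X).
Variable M : lmodType A.
Implicit Types (w : M) (nu : K).

(** The weight [nu] is kept apart from the Casimir parameter [mu], because the singular vector has
    weight [- (mu + 2)]. *)
Record highest_weight w nu : Prop := HighestWeight {
  hw_e : e *: w = 0;
  hw_p : p *: w = 0;
  hw_h : h *: w = cst nu *: w
}.

Lemma ev_eigen w nu a : h *: w = cst nu *: w -> ev a *: w = cst a.[nu] *: w.
Proof.
move=> hw; elim/poly_ind: a => [|a c IH].
  by rewrite horner0 polyC0.
rewrite hornerMXaddC rmorphD rmorphM scalerDl -scalerA hw scalerA.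
rewrite -(cstC W) -scalerA IH scalerA -scalerDl mulrC.
by rewrite polyCD polyCM rmorphD rmorphM.
Qed.

(** Monomials ending in [p] or [e] kill [w], and a polynomial in [h] acts on [w] by its value at
    [nu]. *)
Lemma hw_span w nu x : highest_weight w nu ->
  exists s : seq (nat * nat * K),
    x *: w = \sum_(t <- s) (cst t.2 * (q ^+ t.1.1 * f ^+ t.1.2)) *: w.
Proof.
move=> [ew pw hw]; have [s ->] := monomial_spanning W x.
rewrite scaler_suml; elim: s => [|t s [s' IH]].
  by exists [::]; rewrite !big_nil.
rewrite big_cons IH; case: t => -[a [|b]] [m r]; last first.
  exists s'; rewrite /monomial /= exprSr -(mulrA (p ^+ b)) (p_sl2_mon W) !mulrA.
  by rewrite -scalerA pw scaler0 add0r.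
case: m => k; last first.
  exists s'; rewrite /monomial /= expr0 mul1r exprSr !mulrA.
  by rewrite -scalerA ew scaler0 add0r.
exists ((a, k, r.[nu]) :: s'); rewrite big_cons /monomial /= expr0 mul1r mulrA.
by rewrite -scalerA (ev_eigen _ hw) scalerA -(cstC W).
Qed.

(* [h] only counts the factors [f] of [q ^ a f ^ k w]; the second term counts
   the factors [q]. *)
Definition grading : A := h - cst (2 / zeta) * (q * p).

(** On these vectors [q p] acts as [zeta] times the exponent of [q], since [p] differentiates powers
    of [q] and kills [w]. Thus [w] is the only monomial vector with eigenvalue [nu]. *)
Lemma grading_hw w nu a k : highest_weight w nu ->
  grading *: ((q ^+ a * f ^+ k) *: w) =
  cst (nu - 2 * (a + k)%:R) *: ((q ^+ a * f ^+ k) *: w).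
Proof.
move=> [ew pw hw]; have z0 := zeta_neq0 W.
have qpE : (q * p * (q ^+ a * f ^+ k)) *: w =
    cst (zeta * a%:R) *: ((q ^+ a * f ^+ k) *: w).
  rewrite mulrA -(mulrA q) (p_exp_q W) mulrDr mulrDl scalerDl.
  have pf : p * f ^+ k = f ^+ k * p.
    elim: k => [|k IH]; rewrite ?expr0 ?mulr1 ?mul1r //.
    by rewrite exprS mulrA (pfC W) -!mulrA IH.
  rewrite -!mulrA pf !mulrA -[X in X + _]scalerA pw scaler0 add0r.
  rewrite -(cstC W) -[cst _ * q * _]mulrA scalerA mulrA.
  case: a => [|a]; last by rewrite exprS !mulrA.
  by rewrite mulr0 polyC0 rmorph0 !mul0r.
have hE : (h * (q ^+ a * f ^+ k)) *: w =
    cst (nu - 2 * k%:R) *: ((q ^+ a * f ^+ k) *: w).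
  rewrite mulrA (comm_exp_q _ (qhC W)) -mulrA (ev_f_exp W) shiftpX.
  rewrite mulrA rmorphD mulrDr scalerDl -scalerA hw scalerA -!(cstC W).
  by rewrite -scalerDl -mulrDl -rmorphD -polyCD scalerA mulNrn mulr_natr.
rewrite scalerA /grading mulrBl scalerBl hE.
rewrite -(mulrA (cst _)) -[X in _ - X]scalerA qpE [X in _ - X]scalerA.
rewrite -scalerBl -rmorphM -rmorphB -polyCM -polyCB.
by congr (ev _%:P *: _); rewrite natrD; field.
Qed.

(** Lagrange interpolation: [t] is the product of the factors [(grading - d) / (c - d)] over [d] in
    [s]. *)
Lemma grading_projector (s : seq K) c : c \notin s ->
  exists t, forall d (y : M), grading *: y = cst d *: y ->
    (d \in s -> t *: y = 0) /\ (d = c -> t *: y = y).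
Proof.
elim: s => [|d0 s IH].
  by move=> _; exists 1 => d y _; split=> // _; rewrite scale1r.
rewrite inE negb_or => /andP[cd0 /IH[t tP]].
exists (t * (cst (c - d0)^-1 * (grading - cst d0))) => d y yd.
have E : (cst (c - d0)^-1 * (grading - cst d0)) *: y =
    cst ((d - d0) / (c - d0)) *: y.
  rewrite -scalerA scalerBl yd -scalerBl -rmorphB -polyCB scalerA -rmorphM.
  by rewrite -polyCM mulrC.
rewrite -scalerA E scalerA -(cstC W) -scalerA.
have [td0 tdc] := tP _ _ yd; split=> [|dc].
  rewrite inE => /predU1P[->|/td0 ->]; last by rewrite scaler0.
  by rewrite subrr mul0r polyC0 rmorph0 scale0r.
by rewrite (tdc dc) dc divff ?subr_eq0 // rmorph1 scale1r.
Qed.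

(** The functional [phi] reads off the coefficient of [w]. A projector onto the eigenvalue [nu] of
    [grading] keeps just this component of [x *: w], which is then normalised. *)
Lemma hw_retract (w : M) nu (phi : M -> K) x : highest_weight w nu ->
  {morph phi : y z / y + z} ->
  (forall c a k, phi ((cst c * (q ^+ a * f ^+ k)) *: w) =
     c *+ ((a == 0%N) && (k == 0%N))) ->
  phi (x *: w) != 0 -> exists t, (t * x) *: w = w.
Proof.
move=> hw phiD phiE; have [s xE] := hw_span x hw; rewrite xE.
pose N := (\max_(t <- s) (t.1.1 + t.1.2)).
pose ds := [seq nu - 2 * k.+1%:R | k <- iota 0 N].
have [|t tP] := @grading_projector ds nu.
  apply/mapP => -[k _ /eqP]; rewrite -[X in X == _]subr0.
  by rewrite (inj_eq (addrI _)) eqr_opp eq_sym mulf_eq0 !pnatr_eq0.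
have phi0 : phi 0 = 0 by apply: (addrI (phi 0)); rewrite -phiD !addr0.
rewrite (big_morph phi phiD phi0).
under eq_bigr do rewrite phiE.
set c := \sum_(_ <- _) _ => c0.
suff tx : t *: (x *: w) = cst c *: w.
  by exists (cst c^-1 * t); rewrite -!scalerA tx scalerA -rmorphM -polyCM mulVf //
    rmorph1 scale1r.
rewrite xE scaler_sumr /c !rmorph_sum scaler_suml !big_seq.
apply: eq_bigr => -[[a k] r] /= ars.
rewrite -scalerA scalerA -(cstC W) -scalerA.
have [t0 t1] := tP _ _ (grading_hw a k hw).
have [/andP[/eqP a0 /eqP k0]|/nandP ak] := boolP ((a == 0%N) && (k == 0%N)).
  rewrite t1; last by rewrite a0 k0 mulr0 subr0.
  by rewrite a0 k0 !expr0 mulr1 scale1r.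
rewrite t0 ?polyC0 ?rmorph0 ?scale0r ?scaler0 //.
(* The list [ds] starts at degree 1, hence the predecessor. *)
apply/mapP; exists (a + k).-1.
  rewrite mem_iota add0n prednK /=.
    exact: (@leq_bigmax_seq _ _ xpredT (fun t => (t.1.1 + t.1.2)%N) _ ars).
  by move: ak; rewrite -!lt0n addn_gt0; case=> ->; rewrite ?orbT.
by rewrite prednK // addn_gt0 !lt0n; apply/orP.
Qed.

Lemma hw_f_exp w nu k : highest_weight w nu ->
  ev 'X *: (f ^+ k *: w) = cst (nu - 2 * k%:R) *: (f ^+ k *: w).
Proof.
move=> [ew pw hw]; rewrite scalerA (ev_f_exp W) -scalerA (ev_eigen _ hw).
by rewrite horner_shiftp hornerX !scalerA (cstC W) mulNrn mulr_natr.
Qed.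

(** Applying [e] to the vector gives the factor [casimir_poly mu] evaluated at
    [mu - 2 n - 2 = - (mu + 2)], one of its roots. *)
Lemma hw_singular w n : mu = n%:R -> highest_weight w mu ->
  highest_weight (f ^+ n.+1 *: w) (- (mu + 2)).
Proof.
move=> mun hw; split.
- rewrite scalerA exprS mulrA (efE W) (ev_f_exp W) -scalerA (ev_eigen _ (hw_h hw)).
  rewrite !horner_shiftp (eqP (_ : root (casimir_poly mu) _)).
    by rewrite polyC0 rmorph0 scale0r scaler0.
  rewrite root_casimir_poly mun mulNrn -mulr_natr; apply/orP; right.
  by apply/eqP; ring.
- have pf : p * f ^+ n.+1 = f ^+ n.+1 * p.
    by rewrite (comm_exp_q (q := f)) // (pfC W).
  by rewrite scalerA pf -scalerA (hw_p hw) scaler0.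
- rewrite (hw_f_exp _ hw); congr (ev _%:P *: _).
  by rewrite mun -[n.+1%:R]natr1; ring.
Qed.

(** By simplicity the singular vector [w'] vanishes, so the module is spanned by the
    [q ^+ a * f ^+ k] applied to [w] with [k <= n]. There [h] has the eigenvalues [weightn k], all
    roots of [weight_poly]. *)
Lemma simple_hw_killed w n : simple_module M -> w != 0 ->
  mu = n%:R -> highest_weight w mu -> forall m : M, ev (weight_poly K n) *: m = 0.
Proof.
move=> simM w0 mun hw m; set w' := f ^+ n.+1 *: w.
have hw' := hw_singular mun hw.
have w'0 : w' = 0.
  apply: contrapT => /eqP w'0; case/negP: w0; apply/eqP.
  have [x wE] := simple_module_cyclic w simM w'0.
  have [s xE] := hw_span x hw'.
  pose ds := [seq - (mu + 2) - 2 * (t.1.1 + t.1.2)%:R | t <- s].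
  have [|t tP] := @grading_projector ds mu.
    apply/mapP => -[[[a k] r] _ /=]; rewrite mun => /eqP.
    rewrite -subr_eq0 (_ : _ - _ = (2 * (n + 1 + a + k))%:R); last first.
      by rewrite natrM !natrD; ring.
    by rewrite pnatr_eq0 muln_eq0 /= !addn_eq0 andbF.
  (* The projector fixes [w], yet kills every term of the expansion of [w] in descendants of [w'],
     whose eigenvalues all differ from [mu]. *)
  have gw : grading *: w = cst mu *: w.
    by have := grading_hw 0 0 hw; rewrite !expr0 mulr1 scale1r mulr0 subr0.
  have [_ /(_ erefl)] := tP _ _ gw.
  move=> <-; rewrite {1}wE xE scaler_sumr big_seq big1 // => -[[a k] r] /= ars.
  rewrite -scalerA scalerA -(cstC W) -scalerA.
  have [t0 _] := tP _ _ (grading_hw a k hw').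
  by rewrite t0 ?scaler0 //; apply/mapP; exists (a, k, r).
have [x ->] := simple_module_cyclic m simM w0.
have [s ->] := hw_span x hw; rewrite scaler_sumr big1 // => -[[a k] r] _ /=.
have E : ev (weight_poly K n) * (cst r * (q ^+ a * f ^+ k)) =
    cst r * (q ^+ a * (f ^+ k * ev (shiftp (- 2 *+ k) (weight_poly K n)))).
  rewrite mulrA -(cstC W) -mulrA (mulrA (ev (weight_poly K n))).
  by rewrite (comm_exp_q _ (q_ev W _)) -(mulrA (q ^+ a)) (ev_f_exp W).
rewrite scalerA E -!scalerA (ev_eigen _ (hw_h hw)).
rewrite horner_shiftp; have [kn|nk] := leqP k n.
  rewrite (_ : _.[_] = 0) ?polyC0 ?rmorph0 ?scale0r ?scaler0 //.
  by apply/eqP/root_weight_poly; exists k; rewrite // mun /weightn mulNrn.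
rewrite (scalerA (f ^+ k)) -(cstC W) -scalerA -(subnK nk) exprD -[_ *: w]scalerA.
by rewrite -/w' w'0 !scaler0.
Qed.

(** A nonzero annihilator would contain [ev (weight_poly K n)]. On [w] this acts by its value at
    [- (mu + 2)], that is at [weightn n.+1], which is not a root. *)
Lemma faithful_simple_module w n (phi : M -> K) :
  mu = n%:R -> highest_weight w (- (mu + 2)) ->
  {morph phi : y z / y + z} ->
  (forall c a k, phi ((cst c * (q ^+ a * f ^+ k)) *: w) =
     c *+ ((a == 0%N) && (k == 0%N))) ->
  exists2 L : lmodType A, simple_module L &
    forall a, (forall m : L, a *: m = 0) -> a = 0.
Proof.
(* The submodule generated by [w] is handled as a quotient of the left regular module, through [x]
   sent to [x *: w]. *)
move=> mun hw phiD phiE; pose psi (x : A^o) := phi ((x : A) *: w).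
have phiZ c : phi (cst c *: w) = c.
  by have := phiE c 0 0; rewrite !expr0 !mulr1.
have psiZ a (x : A^o) : psi (a *: x) = phi (a *: ((x : A) *: w)).
  by rewrite scalerA.
have [] := @simple_quotient_of_functional A A^o K psi 1.
- by move=> x y; rewrite /psi scalerDl phiD.
- by rewrite /psi -(rmorph1 ev) phiZ oner_eq0.
- by move=> x; exists x; rewrite [_ *: _]mulr1.
- move=> x /(hw_retract hw phiD phiE)[t tE]; exists t => a.
  by rewrite !psiZ [_ *: x]/(t * x) tE scale1r.
move=> N simN NE; exists (quot_mod N) => // a aN; apply: contrapT => /eqP a0.
have := ideal_weight_poly W mun (annihilator_ideal (quot_mod N))
  (ex_intro2 _ _ a aN a0) (quot_mod_pi N 1).
rewrite -linearZ => /eqP; rewrite quot_mod_pi_eq0 => /NE /(_ 1).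
rewrite scale1r psiZ scale1r (ev_eigen _ (hw_h hw)) phiZ => R0.
have /root_weight_poly[i lein] : root (weight_poly K n) (- (mu + 2)) by apply/eqP.
rewrite mun -weightn_last => /weightn_inj ni; by rewrite -ni ltnn in lein.
Qed.

End HighestWeight.

(** * The sl2-triple commuting with p and q *)

Section SchrodingerRelations.
Variable A : pzRingType.
Implicit Types x y w : A.
Import Ncring Ncring_tac.
Local Open Scope ring_scope.

(** This and the next instance give [non_commutative_ring] access to [A]. *)
Instance pzRing_ops : @Ring_ops A 0 1 +%R *%R (fun x y => x - y) -%R eq := {}.
Instance pzRing_ncring : Ring (Ro := pzRing_ops).
Proof.
split.
- exact: eq_equivalence.
- by move=> ? ? -> ? ? ->.
- by move=> ? ? -> ? ? ->.
- by move=> ? ? -> ? ? ->.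
- by move=> ? ? ->.
- exact: add0r.
- exact: addrC.
- exact: addrA.
- exact: mul1r.
- exact: mulr1.
- exact: mulrA.
- exact: mulrDl.
- by move=> x y w; exact: mulrDr.
- by [].
- exact: subrr.
Qed.

Variables e h f p q z e2 h2 f2 : A.

(* [e2], [h2], [f2] are the sl2-triple commuting with [p] and [q], multiplied by
   [2 z] so that no division by [z] is needed. *)
Record schrodinger_relations : Prop := SchrodingerRelations {
  rel_zC : forall x, z * x = x * z;
  rel_he : h * e = e * h + e + e;
  rel_ef : e * f = f * e + h;
  rel_hf : h * f = f * h - f - f;
  rel_eq : e * q = q * e + p;
  rel_ep : e * p = p * e;
  rel_hp : h * p = p * h + p;
  rel_fp : f * p = p * f + q;
  rel_fq : f * q = q * f;
  rel_hq : h * q = q * h - q;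
  rel_pq : p * q = q * p + z;
  e2E : e2 = z * e + z * e - p * p;
  h2E : h2 = z * h + z * h + p * q + q * p;
  f2E : f2 = z * f + z * f + q * q
}.
Hypothesis S : schrodinger_relations.

Local Notation four x := (x + x + x + x).
(** [4 z ^ 2] times the usual [h ^ 2 + 2 h + 4 f e] of the sl2-triple with the factor [2 z]
    removed. *)
Definition casimir := h2 * h2 + four (z * h2) + four (f2 * e2).

(** Products are nested to the left, so the word [x y] occurs either alone or at the end of
    [w * x * y]; each relation is supplied in both forms. *)
Let rewrite_after x y r : x * y = r -> (x * y = r) * (forall w, w * x * y = w * r).
Proof. by move=> xy; split=> // w; rewrite -mulrA xy. Qed.

Let distr := (@mulrDl A, @mulrDr A, @mulrBl A, @mulrBr A, @mulNr A, @mulrN A, @mulrA A).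
Let z_left x : (x * z = z * x) * (forall w, w * x * z = w * (z * x)).
Proof. exact/rewrite_after/esym/(rel_zC S). Qed.

Ltac nc_ring rules :=
  repeat (progress rewrite ?distr ?z_left ?rules); non_commutative_ring.

Let relations := (rewrite_after (rel_he S), rewrite_after (rel_ef S),
  rewrite_after (rel_hf S), rewrite_after (rel_eq S), rewrite_after (rel_ep S),
  rewrite_after (rel_hp S), rewrite_after (rel_fp S), rewrite_after (rel_fq S),
  rewrite_after (rel_hq S), rewrite_after (rel_pq S)).

Lemma p_e2 : p * e2 = e2 * p.
Proof. by rewrite (e2E S); nc_ring relations. Qed.

Lemma p_h2 : p * h2 = h2 * p.
Proof. by rewrite (h2E S); nc_ring relations. Qed.

Lemma p_f2 : p * f2 = f2 * p.
Proof. by rewrite (f2E S); nc_ring relations. Qed.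

Lemma q_e2 : q * e2 = e2 * q.
Proof. by rewrite (e2E S); nc_ring relations. Qed.

Lemma q_h2 : q * h2 = h2 * q.
Proof. by rewrite (h2E S); nc_ring relations. Qed.

Lemma q_f2 : q * f2 = f2 * q.
Proof. by rewrite (f2E S); nc_ring relations. Qed.

(** Under [ad e], [ad h], [ad f] the elements [e2], [h2], [f2] behave as in the adjoint
    representation. With these brackets only one factor has to be expanded in the later products. *)
Let e_e2 : e * e2 = e2 * e.
Proof. by rewrite (e2E S); nc_ring relations. Qed.

Let e_h2 : e * h2 = h2 * e - e2 - e2.
Proof. by rewrite (h2E S) (e2E S); nc_ring relations. Qed.

Let e_f2 : e * f2 = f2 * e + h2.
Proof. by rewrite (h2E S) (f2E S); nc_ring relations. Qed.

Let h_e2 : h * e2 = e2 * h + e2 + e2.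
Proof. by rewrite (e2E S); nc_ring relations. Qed.

Let h_h2 : h * h2 = h2 * h.
Proof. by rewrite (h2E S); nc_ring relations. Qed.

Let h_f2 : h * f2 = f2 * h - f2 - f2.
Proof. by rewrite (f2E S); nc_ring relations. Qed.

Let f_e2 : f * e2 = e2 * f - h2.
Proof. by rewrite (h2E S) (e2E S); nc_ring relations. Qed.

Let f_h2 : f * h2 = h2 * f + f2 + f2.
Proof. by rewrite (h2E S) (f2E S); nc_ring relations. Qed.

Let f_f2 : f * f2 = f2 * f.
Proof. by rewrite (f2E S); nc_ring relations. Qed.

Let ad_relations := (rewrite_after e_e2, rewrite_after e_h2, rewrite_after e_f2,
  rewrite_after h_e2, rewrite_after h_h2, rewrite_after h_f2,
  rewrite_after f_e2, rewrite_after f_h2, rewrite_after f_f2,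
  rewrite_after p_e2, rewrite_after p_h2, rewrite_after p_f2,
  rewrite_after q_e2, rewrite_after q_h2, rewrite_after q_f2).

Lemma e2_f2 : e2 * f2 = f2 * e2 + z * h2 + z * h2.
Proof. by rewrite (e2E S); nc_ring ad_relations. Qed.

Lemma h2_e2 : h2 * e2 = e2 * h2 + four (z * e2).
Proof. by rewrite (h2E S); nc_ring ad_relations. Qed.

Lemma h2_f2 : h2 * f2 = f2 * h2 - four (z * f2).
Proof. by rewrite (h2E S); nc_ring ad_relations. Qed.

Let sl2_relations := (ad_relations, rewrite_after e2_f2,
  rewrite_after h2_e2, rewrite_after h2_f2).

Lemma casimir_comm x : x \in [:: e; h; f; p; q; z] -> casimir * x = x * casimir.
Proof.
rewrite /casimir !inE => /or4P[/eqP ->|/eqP ->|/eqP ->|/or3P[]/eqP ->].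
all: by rewrite /casimir; nc_ring sl2_relations.
Qed.

End SchrodingerRelations.

(** * The universal property of Verma modules *)

Section EnvelopingActions.
Variables (K : comNzRingType) (g : lieAlgType K).
Local Notation U := (univ_env g).

(** Induction on a term representing [u], with the 1 in [u * 1] generalised to any [v] satisfying
    [P], so that products of terms can be treated one factor at a time. *)
Lemma univ_env_ind (P : U -> Prop) : P 1 ->
  (forall u v, P u -> P v -> P (u + v)) -> (forall a u, P u -> P (a *: u)) ->
  (forall x u, P u -> P (uiota x * u)) -> forall u, P u.
Proof.
move=> P1 PD PZ PM u; rewrite -[u]mulr1 -(ureprK u).
move: (urepr u) => {u} t; move: 1 P1; elim: t => [x|a|s IHs t IHt|s IHs t IHt] v Pv.
- exact: PM.
- by rewrite upi_scal mulr_algl; apply: PZ.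
- by rewrite upiD mulrDl; apply: PD; [apply: IHs|apply: IHt].
- by rewrite upiM -mulrA; apply/IHs/IHt.
Qed.

Variables (M : lmodType K) (r : g -> M -> M).

(** Terms act directly, with products as compositions; [ueq_term_act] lets this descend to the
    enveloping algebra without forming an algebra of endomorphisms. *)
Fixpoint term_act (t : uterm g) : M -> M :=
  match t with
  | UGen x => r x
  | UScal a => fun m => a *: m
  | UAdd s t => fun m => term_act s m + term_act t m
  | UMul s t => fun m => term_act s (term_act t m)
  end.

Record lie_action : Prop := LieAction {
  lie_act_linear : forall x, linear (r x);
  lie_actP : forall a x y m, r (a *: x + y) m = a *: r x m + r y m;
  lie_act_lie : forall x y m, r (lie x y) m = r x (r y m) - r y (r x m)
}.
Hypothesis rP : lie_action.

Lemma term_act_linear t : linear (term_act t).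
Proof.
elim: t => /= [x|b|s IHs t IHt|s IHs t IHt] a m m'.
- exact: lie_act_linear.
- by rewrite scalerDr !scalerA mulrC.
- by rewrite IHs IHt scalerDr addrACA.
- by rewrite IHt IHs.
Qed.

Lemma term_actD t m m' : term_act t (m + m') = term_act t m + term_act t m'.
Proof. by have := term_act_linear t 1 m m'; rewrite !scale1r. Qed.

Lemma term_actZ t a m : term_act t (a *: m) = a *: term_act t m.
Proof.
have t0 : term_act t 0 = 0.
  by apply: (addrI (term_act t 0)); rewrite -term_actD !addr0.
by have := term_act_linear t a m 0; rewrite !t0 !addr0.
Qed.

Lemma ueq_term_act s t : ueq s t -> term_act s =1 term_act t.
Proof.
elim=> {s t}; rewrite /UOpp /=.
- by [].
- by move=> s t _ st m; rewrite st.
- by move=> s t u _ st _ tu m; rewrite st tu.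
- by move=> s s' t t' _ IHs _ IHt m; rewrite IHs IHt.
- by move=> s s' t t' _ IHs _ IHt m; rewrite IHt IHs.
- by move=> s t u m; rewrite addrA.
- by move=> s t m; rewrite addrC.
- by move=> t m; rewrite scale0r add0r.
- by move=> t m; rewrite scaleN1r addNr scale0r.
- by [].
- by move=> t m; rewrite scale1r.
- by move=> t m; rewrite scale1r.
- by [].
- by move=> s t u m; rewrite term_actD.
- by move=> a b m; rewrite scalerDl.
- by move=> a b m; rewrite scalerA.
- by move=> a t m; rewrite term_actZ.
- by move=> x y m; have := lie_actP rP 1 x y m; rewrite !scale1r.
- move=> a x m; have := lie_actP rP a x 0 m.
  have r0 : r 0 m = 0.
    have := lie_actP rP 1 0 0 m; rewrite !scale1r addr0 => /eqP.
    by rewrite -subr_eq0 opprD addNKr oppr_eq0 => /eqP.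
  by rewrite r0 !addr0.
- by move=> x y m; rewrite scaleN1r lie_act_lie.
Qed.

Definition env_act (u : U) : M -> M := term_act (urepr u).

Lemma env_act_pi t : env_act (upi t) =1 term_act t.
Proof. by apply/ueq_term_act/upiP; rewrite ureprK. Qed.

Lemma env_actZ u a m : env_act u (a *: m) = a *: env_act u m.
Proof. exact: term_actZ. Qed.

Lemma env_actDr u m m' : env_act u (m + m') = env_act u m + env_act u m'.
Proof. exact: term_actD. Qed.

Lemma env_act_iota x : env_act (uiota x) =1 r x.
Proof. exact: env_act_pi. Qed.

Lemma env_actD u v m : env_act (u + v) m = env_act u m + env_act v m.
Proof. by rewrite -(ureprK u) -(ureprK v) -upiD !env_act_pi. Qed.

Lemma env_actM u v m : env_act (u * v) m = env_act u (env_act v m).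
Proof. by rewrite -(ureprK u) -(ureprK v) -upiM !env_act_pi. Qed.

Lemma env_act_scal a m : env_act a%:A m = a *: m.
Proof. by rewrite -upi_scal env_act_pi. Qed.

Lemma env_act1 m : env_act 1 m = m.
Proof. by rewrite -[X in env_act X]scale1r env_act_scal scale1r. Qed.

Lemma env_actZl a u m : env_act (a *: u) m = a *: env_act u m.
Proof. by rewrite -mulr_algl env_actM env_act_scal. Qed.

End EnvelopingActions.

Section VermaUniversalProperty.
Variables (K : fieldType) (lambda : {scalar subvs_of (cartan K)}).
Local Notation U := (univ_env (schrodinger K)).
Variables (M : lmodType K) (r : schrodinger K -> M -> M) (v0 : M).
Hypothesis rP : lie_action r.
Hypothesis rv0 : forall x : borel_alg K, r (vsval x) v0 = (weight lambda x : K) *: v0.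

Lemma env_act_borel a :
  env_act r (borel_env K a) v0 = (weight_env lambda a : K) *: v0.
Proof.
elim/univ_env_ind: a => [|u v IHu IHv|a u IHu|x u IHu].
- by rewrite !rmorph1 env_act1 // scale1r.
- by rewrite !rmorphD /= env_actD // IHu IHv scalerDl.
- by rewrite !linearZ /= env_actZl // IHu scalerA.
rewrite !rmorphM env_actM // IHu env_actZ // /borel_env /= ulift_iota.
by rewrite env_act_iota // rv0 /weight_env /= ulift_iota scalerA mulrC.
Qed.

Fixpoint tensor_term_map (t : tterm U (weight_module lambda)) : M :=
  match t with
  | TTens b m => (m : K) *: env_act r b v0
  | TZero => 0
  | TOpp t => - tensor_term_map t
  | TAdd s t => tensor_term_map s + tensor_term_map t
  end.

Lemma teq_tensor_term_map s t :
  teq (borel_env K) s t -> tensor_term_map s = tensor_term_map t.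
Proof.
elim=> //= {s t}.
- by move=> s t u _ -> _ ->.
- by move=> s t _ ->.
- by move=> s s' t t' _ -> _ ->.
- by move=> s t u; rewrite addrA.
- by move=> s t; rewrite addrC.
- by move=> t; rewrite add0r.
- by move=> t; rewrite addNr.
- by move=> b b' m; rewrite env_actD // scalerDr.
- by move=> b m m'; rewrite -scalerDl.
- move=> b a m; rewrite env_actM // env_act_borel env_actZ // scalerA mulrC.
  by [].
Qed.

(** The map out of the Verma module that sends its generator to [v0]; with the explicit model as
    target it detects nonzero vectors. *)
Definition verma_map (x : verma lambda) : M := tensor_term_map (trepr x).

Lemma verma_map_pi t : verma_map (tpi _ t) = tensor_term_map t.
Proof. by apply: teq_tensor_term_map; apply/tpiP; rewrite treprK. Qed.

Lemma verma_mapD x y : verma_map (x + y) = verma_map x + verma_map y.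
Proof. by rewrite -(treprK x) -(treprK y) -tpiD !verma_map_pi. Qed.

Lemma verma_mapZ u x : verma_map (u *: x) = env_act r u (verma_map x).
Proof.
rewrite -(treprK x); elim: (trepr x) => [b m||t IH|s IHs t IHt].
- rewrite -[tpi _ _]/(tens _ b m) tensZ !verma_map_pi /= env_actM //.
  by rewrite env_actZ.
- rewrite tpi0 scaler0 -(tpi0 (borel_env K)) verma_map_pi /=.
  by rewrite -{2}(scale0r 0) env_actZ // scale0r.
- rewrite tpiN scalerN -(treprK (u *: _)) -!tpiN !verma_map_pi /=.
  rewrite -verma_map_pi treprK IH.
  by rewrite verma_map_pi -scaleN1r -(scaleN1r (tensor_term_map t)) env_actZ.
- rewrite tpiD scalerDr !verma_mapD IHs IHt.
  by rewrite -env_actDr.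
Qed.

End VermaUniversalProperty.

(** * An explicit completion of the Verma module *)

Section VermaModel.
Variables (K : numFieldType) (zeta mu : K).
Hypothesis zeta0 : zeta != 0.
Local Notation M := (nat -> nat -> K^o).

(* [F a k] is the coefficient of [q ^ a * f' ^ k] applied to the highest weight
   vector, where [f' = f + q ^ 2 / (2 zeta)]; all coefficients are allowed to
   be nonzero, so that the model is a completion of the Verma module. *)
Definition model_q (F : M) : M := fun a k => if a is a'.+1 then F a' k else 0.
Definition model_p (F : M) : M := fun a k => zeta * a.+1%:R * F a.+1 k.
Definition model_f (F : M) : M := fun a k =>
  (if k is k'.+1 then F a k' else 0) -
  (2 * zeta)^-1 * (if a is a'.+2 then F a' k else 0).
Definition model_h (F : M) : M := fun a k =>
  (mu - 1 / 2 - 2 * k%:R - a%:R) * F a k.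
Definition model_e (F : M) : M := fun a k =>
  k.+1%:R * (mu - k%:R) * F a k.+1 + zeta / 2 * a.+1%:R * a.+2%:R * F a.+2 k.

Definition model_act (x : schrodinger K) (F : M) : M := fun a k =>
  x 0 (@Ordinal 6 0 isT) * model_e F a k + x 0 (@Ordinal 6 1 isT) * model_h F a k +
  x 0 (@Ordinal 6 2 isT) * model_f F a k + x 0 (@Ordinal 6 3 isT) * model_p F a k +
  x 0 (@Ordinal 6 4 isT) * model_q F a k + x 0 (@Ordinal 6 5 isT) * zeta * F a k.

Lemma model_actP : lie_action model_act.
Proof.
have linE c (F G : M) a k : (c *: F + G) a k = c * F a k + G a k by [].
split.
- move=> x c F G; apply/funext => a; apply/funext => k.
  change (model_act x (c *: F + G) a k = c * model_act x F a k + model_act x G a k).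
  rewrite /model_act /model_e /model_h /model_f /model_p /model_q.
  case: a => [|[|a]]; case: k => [|k]; rewrite ?linE; ring.
- move=> c x y F; apply/funext => a; apply/funext => k.
  change (model_act (c *: x + y) F a k = c * model_act x F a k + model_act y F a k).
  rewrite /model_act !mxE; ring.
- move=> x y F; apply/funext => a; apply/funext => k.
  change (model_act (lie x y) F a k =
    model_act x (model_act y F) a k - model_act y (model_act x F) a k).
  rewrite schr_lieE /model_act !Defs.sbracketE.
  move: (x 0 _) (x 0 _) (x 0 _) (x 0 _) (x 0 _) (x 0 _) => x0 x1 x2 x3 x4 x5.
  move: (y 0 _) (y 0 _) (y 0 _) (y 0 _) (y 0 _) (y 0 _) => y0 y1 y2 y3 y4 y5.
  rewrite /model_e /model_h /model_f /model_p /model_q.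
  (* One [f] reaches back by 2 in [a] and by 1 in [k]; a composition of two doubles this, which
     fixes the boundary cases. *)
  case: a => [|[|[|[|a]]]]; case: k => [|[|k]]; rewrite -?natr1; field.
  all: done.
Qed.

End VermaModel.

(** * The enveloping algebra of the Schrodinger algebra *)

Section SchrodingerEnveloping.
Variable K : fieldType.
Local Notation U := (univ_env (schrodinger K)).
Local Notation E := (uiota (se K) : U).
Local Notation H := (uiota (sh K) : U).
Local Notation F := (uiota (sf K) : U).
Local Notation P := (uiota (sp K) : U).
Local Notation Q := (uiota (sq K) : U).
Local Notation Z := (uiota (sz K) : U).

Lemma schrodinger_basis (x : schrodinger K) :
  exists a b c d i j, x =
    a *: se K + b *: sh K + c *: sf K + d *: sp K + i *: sq K + j *: sz K.
Proof.
exists (x 0 (@Ordinal 6 0 isT)), (x 0 (@Ordinal 6 1 isT)), (x 0 (@Ordinal 6 2 isT)),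
  (x 0 (@Ordinal 6 3 isT)), (x 0 (@Ordinal 6 4 isT)), (x 0 (@Ordinal 6 5 isT)).
by apply: Defs.schrP; rewrite !mxE !eqE /=; ring.
Qed.

Lemma schrodinger_env_ind (S : U -> Prop) : S 1 ->
  (forall u v, S u -> S v -> S (u + v)) -> (forall a u, S u -> S (a *: u)) ->
  (forall u, S u -> S (E * u)) -> (forall u, S u -> S (H * u)) ->
  (forall u, S u -> S (F * u)) -> (forall u, S u -> S (P * u)) ->
  (forall u, S u -> S (Q * u)) -> (forall u, S u -> S (Z * u)) -> forall u, S u.
Proof.
move=> S1 SD SZ Se Sh Sf Sp Sq Sz; apply: univ_env_ind => // x u Su.
have [a [b [c [d [i [j ->]]]]]] := schrodinger_basis x.
rewrite !linearD !linearZ /= !mulrDl -!scalerAl.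
apply: (SD _ _ (SD _ _ (SD _ _ (SD _ _ (SD _ _ _ _) _) _) _) _); apply: SZ; auto.
Qed.

Lemma schrodinger_env_center (c : U) :
  (forall g, g \in [:: E; H; F; P; Q; Z] -> c * g = g * c) -> center c.
Proof.
move=> cg; elim/schrodinger_env_ind.
- by rewrite mul1r mulr1.
- by move=> u v cu cv; rewrite mulrDl mulrDr cu cv.
- by move=> a u cu; rewrite -scalerAl -scalerAr cu.
all: by move=> u cu; rewrite mulrA cg ?inE ?eqxx ?orbT // -!mulrA cu.
Qed.

Definition envE : U := Z * E + Z * E - P * P.
Definition envH : U := Z * H + Z * H + P * Q + Q * P.
Definition envF : U := Z * F + Z * F + Q * Q.

Lemma env_relations : schrodinger_relations E H F P Q Z envE envH envF.
Proof.
have B := schrodinger_brackets K.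
have lieE (x y w : schrodinger K) : lie x y = w ->
    (uiota x : U) * uiota y = uiota y * uiota x + uiota w.
  by move=> <-; rewrite uiota_lie addrC subrK.
have zx (x : schrodinger K) : Z * uiota x = uiota x * Z.
  by rewrite (lieE _ _ 0) ?B // linear0 addr0.
split => //.
- apply: schrodinger_env_center => g; rewrite !inE.
  by move=> /or4P[/eqP ->|/eqP ->|/eqP ->|/or3P[]/eqP ->]; exact: zx.
- by rewrite (lieE _ _ (2 *: se K)) ?B // scaler_nat mulr2n linearD addrA.
- by rewrite (lieE _ _ (sh K)) ?B.
- rewrite (lieE _ _ (- 2 *: sf K)) ?B // scaleNr scaler_nat mulr2n opprD.
  by rewrite linearD linearN addrA.
- by rewrite (lieE _ _ (sp K)) ?B.
- by rewrite (lieE _ _ 0) ?B // linear0 addr0.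
- by rewrite (lieE _ _ (sp K)) ?B.
- by rewrite (lieE _ _ (sq K)) ?B.
- by rewrite (lieE _ _ 0) ?B // linear0 addr0.
- by rewrite (lieE _ _ (- sq K)) ?B // linearN.
- by rewrite (lieE _ _ (sz K)) ?B.
Qed.

End SchrodingerEnveloping.

(** * The generator of the Verma module *)

Section VermaModule.
Variables (K : fieldType) (lambda : {scalar subvs_of (cartan K)}).
Local Notation U := (univ_env (schrodinger K)).

Definition verma_vector : verma lambda :=
  tens (borel_env K) 1 (1 : weight_module lambda).
Local Notation v := verma_vector.

Lemma tens_verma_vector b (m : weight_module lambda) :
  tens (borel_env K) b m = (b * (m : K)%:A) *: v.
Proof.
have wm : weight_env lambda (m : K)%:A = m by rewrite linearZ rmorph1 /= [_ *: _]mulr1.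
have {1}-> : m = ((m : K)%:A : univ_env (borel_alg K)) *: (1 : weight_module lambda).
  by change ((m : K) = (weight_env lambda (m : K)%:A : K) * 1); rewrite wm mulr1.
have bm : borel_env K (m : K)%:A = (m : K)%:A by rewrite linearZ rmorph1.
transitivity (tens (borel_env K) (b * borel_env K (m : K)%:A)
    (1 : weight_module lambda)).
  exact/esym/tens_balanced.
by rewrite bm /verma_vector tensZ mulr1.
Qed.

Lemma verma_cyclic (x : verma lambda) : exists u : U, x = u *: v.
Proof.
rewrite -(treprK x); elim: (trepr x) => [b m||t [u IH]|s [u IHs] t [u' IHt]].
- exists (b * (m : K)%:A); exact: tens_verma_vector.
- by exists 0; rewrite tpi0 scale0r.
- by exists (- u); rewrite tpiN IH scaleNr.
- by exists (u + u'); rewrite tpiD IHs IHt scalerDl.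
Qed.

Lemma borel_verma_vector (x : borel_alg K) :
  (uiota (vsval x) : U) *: v = ((weight lambda x : K)%:A : U) *: v.
Proof.
have -> : (uiota (vsval x) : U) = borel_env K (uiota x).
  by rewrite /borel_env /= ulift_iota.
transitivity (tens (borel_env K) 1
    ((uiota x : univ_env _) *: (1 : weight_module lambda))).
  rewrite /verma_vector tensZ mulr1 -[borel_env K _]mul1r.
  exact: tens_balanced.
rewrite (_ : _ *: (1 : weight_module lambda) = weight lambda x).
  by rewrite tens_verma_vector mul1r.
change ((weight_env lambda (uiota x) : K) * 1 = weight lambda x).
by rewrite mulr1 /weight_env /= ulift_iota.
Qed.

Lemma cartan_borel x : x \in cartan K -> x \in borel K.
Proof. by apply: subvP; exact: addvSl. Qed.

Lemma nplus_borel x : x \in nplus K -> x \in borel K.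
Proof. by apply: subvP; exact: addvSr. Qed.

Lemma weight_coord (x : borel_alg K) : weight lambda x =
  vsval x 0 (@Ordinal 6 1 isT) * lambda (hC K) +
  vsval x 0 (@Ordinal 6 5 isT) * lambda (zC K).
Proof.
case: x => x xb; have /memv_addP[c cc [n nn xE]] := xb.
pose cb : borel_alg K := Subvs (cartan_borel cc).
pose nb : borel_alg K := Subvs (nplus_borel nn).
have -> : (Subvs xb : borel_alg K) = cb + nb by apply: subvs_inj; rewrite linearD.
have -> : weight lambda (cb + nb) = weight lambda cb.
  by rewrite [LHS]linearD /= (@weight_nplus _ lambda nb nn) addr0.
rewrite (@weight_cartan _ lambda cb cc) /=.
have -> : Subvs cc = c 0 (@Ordinal 6 1 isT) *: hC K + c 0 (@Ordinal 6 5 isT) *: zC K.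
  apply: subvs_inj; rewrite linearD !linearZ /= /hC /zC.
  rewrite !vsprojK ?sh_cartan ?sz_cartan //.
  exact/Defs.cartanP.
by rewrite linearD !linearZ /= !Defs.schrD !(Defs.nplus0 nn) !addr0.
Qed.

End VermaModule.

(** * The sl2-triple and the Weyl algebra in [U_lambda] *)

Section CentralQuotient.
Variables (K : numClosedFieldType) (lambda : {scalar subvs_of (cartan K)}).
Local Notation U := (univ_env (schrodinger K)).
Local Notation E := (uiota (se K) : U).
Local Notation H := (uiota (sh K) : U).
Local Notation F := (uiota (sf K) : U).
Local Notation P := (uiota (sp K) : U).
Local Notation Q := (uiota (sq K) : U).
Local Notation Z := (uiota (sz K) : U).
Local Notation v := (verma_vector lambda).
Local Notation zeta := (lambda (zC K)).
Local Notation mu := (lambda (hC K) + 1 / 2).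
Hypothesis zeta0 : zeta != 0.

Lemma generators_verma_vector :
  (E *: v = 0) * (P *: v = 0) * (H *: v = ((mu - 1 / 2)%:A : U) *: v) *
  (Z *: v = (zeta%:A : U) *: v).
Proof.
have act (x : schrodinger K) (xb : x \in borel K) : (uiota x : U) *: v =
    ((x 0 (@Ordinal 6 1 isT) * lambda (hC K) +
      x 0 (@Ordinal 6 5 isT) * zeta)%:A : U) *: v.
  have := borel_verma_vector lambda (Subvs xb : borel_alg K).
  by rewrite weight_coord.
have seb : se K \in borel K by rewrite nplus_borel // (subvP (addvSl _ _)) ?memv_line.
have spb : sp K \in borel K by rewrite nplus_borel // (subvP (addvSr _ _)) ?memv_line.
have shb := cartan_borel (sh_cartan K).
have szb := cartan_borel (sz_cartan K).
rewrite !act // !mxE !eqE /=.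
by do !split; rewrite ?mul0r ?mul1r ?addr0 ?add0r ?scale0r ?addrK.
Qed.

Definition model_vector : nat -> nat -> K^o :=
  fun a k => ((a == 0%N) && (k == 0%N))%:R.

Lemma model_vector_weight (x : borel_alg K) :
  model_act zeta mu (vsval x) model_vector = (weight lambda x : K) *: model_vector.
Proof.
apply/funext => a; apply/funext => k.
change (model_act zeta mu (vsval x) model_vector a k =
  weight lambda x * model_vector a k).
rewrite weight_coord /model_act !(Defs.borel0 (subvsP x)) !mul0r !addr0.
rewrite /model_e /model_h /model_p /model_vector.
by case: a => [|a]; case: k => [|k] /=; rewrite ?andbF; ring.
Qed.

Definition verma_coef : verma lambda -> nat -> nat -> K^o :=
  verma_map (model_act zeta mu) model_vector.
Local Notation act := (env_act (model_act zeta mu)).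
Let actP := model_actP mu zeta0.

Lemma verma_coef_vector : verma_coef v = model_vector.
Proof.
rewrite /verma_coef /verma_vector /tens verma_map_pi //=; last first.
  exact: model_vector_weight.
by rewrite env_act1 // scale1r.
Qed.

Lemma verma_coefZ u x : verma_coef (u *: x) = act u (verma_coef x).
Proof. by apply: verma_mapZ => //; exact: model_vector_weight. Qed.

Lemma verma_coefD x y a k :
  verma_coef (x + y) a k = verma_coef x a k + verma_coef y a k.
Proof. by rewrite /verma_coef verma_mapD //; exact: model_vector_weight. Qed.

Local Notation A := (U_lambda lambda).
Local Notation pi := (quot_ring_pi (central_ideal lambda)).

(** As the Verma module is cyclic, [c - a] kills all of it, so it belongs to the maximal ideal of
    the centre that is divided out. *)
Lemma central_killing_vector (c : U) a : center c -> c *: v = (a%:A : U) *: v ->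
  pi c = pi a%:A.
Proof.
move=> cc cv; apply/eqP; rewrite -subr_eq0 -rmorphB quot_ring_pi_eq0.
apply/asboolP; exists 1%N, (fun=> 1), (fun=> c - a%:A); split; last first.
  by rewrite big_ord1 mul1r.
move=> _; split=> [x|x]; first by rewrite mulrBl mulrBr cc mulr_algl mulr_algr.
have [u ->] := verma_cyclic x; rewrite scalerA.
have -> : (c - a%:A) * u = u * (c - a%:A).
  by rewrite mulrBl mulrBr cc mulr_algl mulr_algr.
by rewrite -scalerA scalerBl cv subrr scaler0.
Qed.

Lemma pi_Z : pi Z = pi zeta%:A.
Proof.
apply: central_killing_vector; last by rewrite generators_verma_vector.
exact: (rel_zC (env_relations K)).
Qed.

Local Notation Om := (casimir Z (envE K) (envH K) (envF K)).

Lemma pi_casimir : pi Om = pi (4 * zeta ^+ 2 * (mu * (mu + 2)))%:A.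
Proof.
have G := generators_verma_vector.
apply: central_killing_vector.
  by apply: schrodinger_env_center => g; apply: (casimir_comm (env_relations K)).
pose eig (u : U) a := u *: v = (a%:A : U) *: v.
have eigD u w a b : eig u a -> eig w b -> eig (u + w) (a + b).
  by rewrite /eig !scalerDl => -> ->.
have eigM u w a b : eig u a -> eig w b -> eig (u * w) (a * b).
  rewrite /eig -scalerA => ua ->; rewrite scalerA.
  have -> : u * b%:A = b%:A * u by rewrite mulr_algl mulr_algr.
  by rewrite -[LHS]scalerA ua scalerA mulr_algl scalerA mulrC.
have eig0 u a : u *: v = 0 -> eig (a * u) 0.
  by rewrite /eig -scalerA scale0r scale0r => ->; rewrite scaler0.
have EE : eig (envE K) 0.
  rewrite /envE -mulNr; have -> : 0 = 0 + 0 + 0 :> K by rewrite !addr0.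
  by apply (eigD); [apply (eigD)|]; apply (eig0); rewrite G.
(* On the generator [P Q] acts as [[P, Q] = Z]; this is the origin of the shift by 1/2 between
   [lambda(h)] and [mu]. *)
have EPQ : eig (P * Q) zeta.
  rewrite (rel_pq (env_relations K)) -[zeta]add0r.
  by apply (eigD); [apply (eig0)|]; rewrite /eig !G.
have EZ : eig Z zeta by rewrite /eig !G.
have EH : eig (envH K) (2 * zeta * mu).
  have -> : 2 * zeta * mu =
      zeta * (mu - 1 / 2) + zeta * (mu - 1 / 2) + zeta + 0 by field.
  have EhH : eig H (mu - 1 / 2) by rewrite /eig G.
  have EZH := eigM _ _ _ _ EZ EhH.
  have EQP : eig (Q * P) 0 by apply (eig0); rewrite G.
  exact: (eigD _ _ _ _ (eigD _ _ _ _ (eigD _ _ _ _ EZH EZH) EPQ) EQP).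
rewrite -/(eig _ _) /casimir.
set y := 2 * zeta * mu in EH.
have -> : 4 * zeta ^+ 2 * (mu * (mu + 2)) = y * y +
    (zeta * y + zeta * y + zeta * y + zeta * y) + (0 + 0 + 0 + 0).
  by rewrite /y; ring.
have eFE : eig (envF K * envE K) 0.
  by apply (eig0); rewrite EE scale0r scale0r.
have EZH := eigM _ _ _ _ EZ EH; have EHH := eigM _ _ _ _ EH EH.
exact: (eigD _ _ _ _ (eigD _ _ _ _ EHH
  (eigD _ _ _ _ (eigD _ _ _ _ (eigD _ _ _ _ EZH EZH) EZH) EZH))
  (eigD _ _ _ _ (eigD _ _ _ _ (eigD _ _ _ _ eFE eFE) eFE) eFE)).
Qed.

Definition quot_h : U := (2 * zeta)^-1 *: envH K.
(** Evaluation at the [h] of the commuting sl2-triple, not at the image of [sh]. It also supplies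
    the scalars, since [U_lambda] is declared as a ring only. *)
Definition quot_ev : {rmorphism {poly K} -> A} := pi \o horner_alg quot_h.
Definition quot_e : A := pi ((2 * zeta)^-1 *: envE K).
Definition quot_f : A := pi ((2 * zeta)^-1 *: envF K).
Local Notation cst c := (quot_ev c%:P).

Lemma quot_ev_cst c : cst c = pi c%:A.
Proof. by rewrite /quot_ev /= horner_algC. Qed.

Lemma quot_evX : quot_ev 'X = pi quot_h.
Proof. by rewrite /quot_ev /= horner_algX. Qed.

Lemma pi_surj (x : A) : exists u, x = pi u.
Proof. by elim/quotW: x => u; exists u. Qed.

Lemma piZ a u : pi (a *: u) = cst a * pi u.
Proof. by rewrite quot_ev_cst -rmorphM mulr_algl. Qed.

Lemma quot_cstC c x : cst c * x = x * cst c.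
Proof.
have [u ->] := pi_surj x.
by rewrite quot_ev_cst -!rmorphM mulr_algl mulr_algr.
Qed.

Lemma quot_cst_inj c x y : c != 0 -> cst c * x = cst c * y -> x = y.
Proof.
move=> c0 /(congr1 (fun t => cst c^-1 * t)).
by rewrite !mulrA -rmorphM -polyCM mulVf // rmorph1 !mul1r.
Qed.

Let two_zeta0 : 2 * zeta != 0. Proof. by rewrite mulf_neq0 ?pnatr_eq0. Qed.

Lemma pi_envE : pi (envE K) = cst (2 * zeta) * quot_e.
Proof. by rewrite /quot_e piZ mulrA -rmorphM -polyCM divff // rmorph1 mul1r. Qed.

Lemma pi_envF : pi (envF K) = cst (2 * zeta) * quot_f.
Proof. by rewrite /quot_f piZ mulrA -rmorphM -polyCM divff // rmorph1 mul1r. Qed.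

Lemma pi_envH : pi (envH K) = cst (2 * zeta) * quot_ev 'X.
Proof.
by rewrite quot_evX /quot_h piZ mulrA -rmorphM -polyCM divff // rmorph1 mul1r.
Qed.

Let cstMM c x y : cst c * x * (cst c * y) = cst (c ^+ 2) * (x * y).
Proof.
by rewrite -mulrA (mulrA x) -(quot_cstC c x) -mulrA mulrA -rmorphM -polyCM expr2.
Qed.

Let quot_ef_commute : quot_e * quot_f = quot_f * quot_e + quot_ev 'X.
Proof.
have : pi (envE K) * pi (envF K) =
    pi (envF K) * pi (envE K) + pi Z * pi (envH K) + pi Z * pi (envH K).
  by rewrite -!rmorphM (e2_f2 (env_relations K)) -!rmorphD.
rewrite pi_envE pi_envF pi_envH pi_Z -quot_ev_cst !cstMM.
move=> H1; apply: (@quot_cst_inj ((2 * zeta) ^+ 2)); first by rewrite expf_neq0.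
rewrite H1 mulrDr -addrA -!rmorphM -rmorphD; congr (_ + quot_ev _).
ring.
Qed.

(** The equation of [pi_casimir] is solved for [f e], after multiplication by [(4 zeta) ^+ 2] to
    clear the denominators. *)
Let quot_fe : quot_f * quot_e = quot_ev (casimir_poly mu).
Proof.
have : pi (envH K) * pi (envH K) + (pi Z * pi (envH K) + pi Z * pi (envH K) +
    pi Z * pi (envH K) + pi Z * pi (envH K)) + (pi (envF K) * pi (envE K) +
    pi (envF K) * pi (envE K) + pi (envF K) * pi (envE K) + pi (envF K) * pi (envE K)) =
    pi (4 * zeta ^+ 2 * (mu * (mu + 2)))%:A.
  by rewrite -pi_casimir -!rmorphM -!rmorphD.
rewrite pi_envE pi_envF pi_envH pi_Z -!quot_ev_cst !cstMM.
set x := quot_f * quot_e; set y := cst _ * x => H1.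
apply: (@quot_cst_inj ((4 * zeta) ^+ 2)).
  by rewrite expf_neq0 // mulf_neq0 ?pnatr_eq0.
have -> : cst ((4 * zeta) ^+ 2) * x = y + y + y + y.
  by rewrite /y -!mulrDl -!rmorphD; congr (quot_ev _%:P * _); ring.
pose c := cst zeta * (cst (2 * zeta) * quot_ev 'X).
rewrite -[y + y + y + y](addKr (cst ((2 * zeta) ^+ 2) *
  (quot_ev 'X * quot_ev 'X) + (c + c + c + c))) /c.
rewrite H1 -!rmorphM -!rmorphD -rmorphN -rmorphD; congr (quot_ev _).
have -> : ((4 * zeta) ^+ 2)%:P * casimir_poly mu =
    (- (4 * zeta ^+ 2))%:P * (('X - mu%:P) * ('X + (mu + 2)%:P)).
  by rewrite /casimir_poly -mul_polyC mulrA -polyCM; congr (_%:P * _); field.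
ring.
Qed.

Let pi_Z_double x : pi Z * x + pi Z * x = cst (2 * zeta) * x.
Proof.
by rewrite pi_Z -quot_ev_cst -mulrDl -rmorphD -polyCD; congr (quot_ev _%:P * _); ring.
Qed.

Let two_zeta_cancel x y w : cst (2 * zeta) * x = cst (2 * zeta) * y + w ->
  x = y + cst (2 * zeta)^-1 * w.
Proof.
move=> xE; apply: (quot_cst_inj two_zeta0); rewrite xE mulrDr.
by rewrite [X in _ = _ + X]mulrA -rmorphM -polyCM divff // rmorph1 mul1r.
Qed.

Lemma quot_cstN1 x : cst (- 1) * x = - x.
Proof. by rewrite polyCN rmorphN rmorph1 mulN1r. Qed.

(** This and the next two lemmas recover the original generators from the triple, [P] and [Q], as
    the generation clause of [weyl_sl2] requires. *)
Lemma pi_E : pi E = quot_e + cst (2 * zeta)^-1 * (pi P * pi P).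
Proof.
apply: two_zeta_cancel; rewrite -pi_envE -pi_Z_double.
by rewrite /envE rmorphB rmorphD !rmorphM subrK.
Qed.

Lemma pi_F : pi F = quot_f + cst (2 * zeta)^-1 * (cst (- 1) * (pi Q * pi Q)).
Proof.
apply: two_zeta_cancel; rewrite -pi_envF -pi_Z_double quot_cstN1.
by rewrite /envF !rmorphD !rmorphM addrK.
Qed.

Lemma pi_H : pi H = quot_ev 'X +
  cst (2 * zeta)^-1 * (cst (- 1) * (pi P * pi Q + pi Q * pi P)).
Proof.
apply: two_zeta_cancel; rewrite -pi_envH -pi_Z_double quot_cstN1.
by rewrite /envH !rmorphD !rmorphM -(addrA (_ + _) (pi P * _)) addrK.
Qed.

(** The relations are those of [U] with [Z] replaced by [zeta], divided by powers of [2 zeta]. *)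
Lemma quot_weyl_sl2 : weyl_sl2 quot_ev quot_e quot_f (pi P) (pi Q) zeta mu.
Proof.
have rel := env_relations K; have z2 : (2 * zeta) ^+ 2 != 0 by rewrite expf_neq0.
have comm u w : u * w = w * u ->
    pi u * pi ((2 * zeta)^-1 *: w) = pi ((2 * zeta)^-1 *: w) * pi u.
  by move=> uw; rewrite -!rmorphM -scalerAr uw -scalerAl.
split=> //.
- exact: quot_cstC.
- by rewrite quot_ev_cst -pi_Z -!rmorphM -rmorphD (rel_pq rel).
- by rewrite /quot_e; apply: comm; exact: (p_e2 rel).
- by rewrite quot_evX /quot_h; apply: comm; exact: (p_h2 rel).
- by rewrite /quot_f; apply: comm; exact: (p_f2 rel).
- by rewrite /quot_e; apply: comm; exact: (q_e2 rel).
- by rewrite quot_evX /quot_h; apply: comm; exact: (q_h2 rel).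
- by rewrite /quot_f; apply: comm; exact: (q_f2 rel).
- have : pi (envH K) * pi (envE K) = pi (envE K) * pi (envH K) +
      (pi Z * pi (envE K) + pi Z * pi (envE K) +
       pi Z * pi (envE K) + pi Z * pi (envE K)).
    by rewrite -!rmorphM (h2_e2 rel) -!rmorphD.
  rewrite pi_envE pi_envH pi_Z -quot_ev_cst !cstMM => H1; apply: (quot_cst_inj z2).
  rewrite mulrBl mulrBr H1; apply/eqP; rewrite eq_sym subr_eq; apply/eqP.
  by congr (_ + _); rewrite !mulrA -!rmorphM -!mulrDl -!rmorphD;
    congr (quot_ev _ * _); ring.
- have : pi (envH K) * pi (envF K) = pi (envF K) * pi (envH K) -
      (pi Z * pi (envF K) + pi Z * pi (envF K) +
       pi Z * pi (envF K) + pi Z * pi (envF K)).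
    by rewrite -!rmorphM (h2_f2 rel) -!rmorphD -rmorphB.
  rewrite pi_envF pi_envH pi_Z -quot_ev_cst !cstMM => H1; apply: (quot_cst_inj z2).
  rewrite [(quot_ev 'X + _) * _]mulrDl [RHS]mulrDr H1; apply/eqP.
  rewrite -addrA eq_sym -subr_eq0 addrAC subrr add0r addrC subr_eq0; apply/eqP.
  by rewrite !mulrA -!rmorphM -!mulrDl -!rmorphD;
    congr (quot_ev _ * _); ring.
- by rewrite quot_ef_commute quot_fe casimir_poly_shift rmorphD.
move=> S S1 SD Sc Se Sh Sf Sp Sq x; have [u ->] := pi_surj x.
have piM (u1 u2 : U) : pi (u1 * u2) = pi u1 * pi u2 by exact: rmorphM.
elim/schrodinger_env_ind: u.
- by rewrite rmorph1.
- by move=> u w Su Sw; rewrite rmorphD; apply: SD.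
- by move=> a u Su; rewrite piZ; apply: Sc.
- move=> u Su; rewrite piM pi_E mulrDl -!mulrA.
  by apply: SD; [exact: Se|apply/Sc/Sp/Sp].
- move=> u Su; rewrite piM pi_H mulrDl -!mulrA [(pi P * pi Q + _) * _]mulrDl -!mulrA.
  by apply (SD); [exact: Sh|apply/Sc/Sc; apply: SD; [apply/Sp/Sq|apply/Sq/Sp]].
- move=> u Su; rewrite piM pi_F mulrDl -!mulrA.
  by apply: SD; [exact: Sf|apply/Sc/Sc/Sq/Sq].
- by move=> u Su; rewrite piM; apply: Sp.
- by move=> u Su; rewrite piM; apply: Sq.
- by move=> u Su; rewrite piM pi_Z -quot_ev_cst; apply: Sc.
Qed.

End CentralQuotient.

(** * Primitive ideals *)

(** Existence of a simple quotient excludes the dummy branch of [simple_quotient_kernel]. *)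
Lemma simple_quotient_simple (A : pzRingType) (M : lmodType A) :
  (exists N : submodClosed M, simple_module (quot_mod N)) ->
  simple_module (simple_quotient M).
Proof.
move=> exN; rewrite /simple_quotient /simple_quotient_kernel.
by case: pselect => // exN'; case: cid.
Qed.

Lemma descent_simple (A : pzRingType) (I : twoSidedIdeal A) (M : lmodType A)
    (killM : forall a (m : M), a \in I -> a *: m = 0) :
  simple_module M -> simple_module (descent killM).
Proof.
move=> [[m m0] simM]; split; first by exists m.
move=> N; pose N' : {pred M} := fun x => (x : descent killM) \in N.
have Nclosed : submod_closed N'.
  split; first exact: (@rpred0 _ N).
  move=> a x y Nx Ny; apply: (@rpredD _ N) => //.
  by have := @rpredZ _ _ N (quot_ring_pi I a) _ Nx; rewrite descentZ.
pose C := GRing.isSubmodClosed.Build A M N' (GRing.submod_closed_semi Nclosed).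
pose N'' : submodClosed M := HB.pack N' C.
by have [NE|NE] := simM N''; [left|right] => x; have := NE x.
Qed.

Section PrimitiveIdeals.
Variables (K : numClosedFieldType) (lambda : {scalar subvs_of (cartan K)}).
Local Notation U := (univ_env (schrodinger K)).
Local Notation E := (uiota (se K) : U).
Local Notation H := (uiota (sh K) : U).
Local Notation F := (uiota (sf K) : U).
Local Notation P := (uiota (sp K) : U).
Local Notation Q := (uiota (sq K) : U).
Local Notation Z := (uiota (sz K) : U).
Local Notation zeta := (lambda (zC K)).
Local Notation mu := (lambda (hC K) + 1 / 2).
Local Notation A := (U_lambda lambda).
Local Notation pi := (quot_ring_pi (central_ideal lambda)).
Local Notation ev := (quot_ev lambda).
Local Notation e := (quot_e lambda).
Local Notation f := (quot_f lambda).
Local Notation cst c := (ev c%:P).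
Hypothesis zeta0 : zeta != 0.
Let W := quot_weyl_sl2 zeta0.

Lemma central_ideal_kills_verma (a : U) (m : verma lambda) :
  a \in central_ideal lambda -> a *: m = 0.
Proof.
move=> /asboolP[n [u [c [cm ->]]]]; rewrite scaler_suml big1 // => i _.
by rewrite -scalerA; have [_ ->] := cm i; rewrite scaler0.
Qed.

Definition quot_verma : lmodType A := descent central_ideal_kills_verma.
Local Notation V := quot_verma.
Local Notation v := (verma_vector lambda : V).

Lemma quot_vermaZ u (x : V) : pi u *: x = u *: (x : verma lambda) :> V.
Proof. exact: descentZ. Qed.

Definition coef (x : V) : nat -> nat -> K^o := verma_coef x.
Local Notation act := (env_act (model_act zeta mu)).
Let actP := model_actP mu zeta0.

Lemma coefD x y a k : coef (x + y) a k = coef x a k + coef y a k.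
Proof. exact: verma_coefD. Qed.

Lemma coef_pi u x : coef (pi u *: x) = act u (coef x).
Proof. by rewrite quot_vermaZ /coef (verma_coefZ zeta0). Qed.

Lemma coef_cst c x a k : coef (cst c *: x) a k = c * coef x a k.
Proof. by rewrite quot_ev_cst coef_pi env_act_scal. Qed.

Lemma coef_q x a k : coef (pi Q *: x) a k = model_q (coef x) a k.
Proof.
rewrite coef_pi env_act_iota // /model_act !mxE !eqE /=.
by rewrite !(mul0r, add0r, addr0) mul1r.
Qed.

Lemma coef_f x a k : coef (f *: x) a k =
  if k is k'.+1 then coef x a k' else 0.
Proof.
have -> : f = pi F + cst (2 * zeta)^-1 * (pi Q * pi Q).
  by rewrite (pi_F zeta0) quot_cstN1 mulrN subrK.
rewrite scalerDl coefD -!scalerA coef_cst !coef_q.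
rewrite coef_pi env_act_iota // /model_act !mxE !eqE /= !(mul0r, add0r, addr0).
rewrite mul1r /model_f.
have -> : model_q (coef (pi Q *: x)) a k = if a is a'.+2 then coef x a' k else 0.
  by case: a => [|[|a]] //=; rewrite coef_q.
by rewrite subrK.
Qed.

Lemma coef_f_exp k x a j : coef (f ^+ k *: x) a j =
  if (k <= j)%N then coef x a (j - k)%N else 0.
Proof.
elim: k j => [|k IH] j; first by rewrite expr0 scale1r subn0.
by rewrite exprS -scalerA coef_f; case: j => [|j]; rewrite ?IH.
Qed.

Lemma coef_q_exp a x j :
  coef (pi Q ^+ a *: x) 0 j = if a == 0%N then coef x 0 j else 0.
Proof.
by case: a => [|a]; rewrite ?expr0 ?scale1r // exprS -scalerA coef_q.
Qed.

(** In the model [q] and the modified [f] are pure shifts of the indices. The case 0 serves the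
    generator of the Verma module, the case [n.+1] its singular vector. *)
Lemma coef_hw_monomial n c a k :
  coef ((cst c * (pi Q ^+ a * f ^+ k)) *: (f ^+ n *: v)) 0 n =
  c *+ ((a == 0%N) && (k == 0%N)).
Proof.
rewrite -!scalerA coef_cst coef_q_exp scalerA -exprD coef_f_exp.
rewrite [coef v]verma_coef_vector // /model_vector.
case: a => [|a] /=; last by rewrite mulr0.
case: k => [|k] /=; first by rewrite leqnn subnn mulr1.
by rewrite addSn ltnNge leq_addl mulr0.
Qed.

Lemma pi1_neq0 : (1 : A) != 0.
Proof.
apply/eqP => A0; have := coef_hw_monomial 0 1 0 0.
rewrite -[(cst 1 * _)]mulr1 A0 mulr0 scale0r.
(* Additivity shows that the zero vector has coefficient 0. *)
have := coefD 0 0 0 0; rewrite addr0 => /eqP; rewrite -subr_eq0 opprD addNKr oppr_eq0.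
by move=> /eqP -> /esym/eqP; rewrite oner_eq0.
Qed.

Lemma quot_verma_hw : highest_weight ev e (pi P) v mu.
Proof.
have G := generators_verma_vector lambda.
have Pv : pi P *: v = 0 by rewrite quot_vermaZ G.
split => //.
- have -> : e = pi E - cst (2 * zeta)^-1 * (pi P * pi P) by rewrite (pi_E zeta0) addrK.
  by rewrite scalerBl -!scalerA Pv !scaler0 subr0 quot_vermaZ G.
- have -> : ev 'X = pi H + cst (2 * zeta)^-1 * (pi P * pi Q + pi Q * pi P).
    by rewrite (pi_H zeta0) quot_cstN1 mulrN subrK.
  rewrite (pqE W) scalerDl -scalerA !scalerDl -!scalerA Pv scaler0 add0r addr0.
  rewrite quot_vermaZ G -quot_vermaZ -quot_ev_cst scalerA -scalerDl -rmorphM -rmorphD.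
  by congr (ev _ *: _); rewrite -polyCM -polyCD; congr (_%:P); field.
Qed.

(** Divide by the largest submodule on which the coefficient of the generator vanishes. *)
Lemma verma_simple_quotient :
  exists N : submodClosed (verma lambda), simple_module (quot_mod N).
Proof.
pose psi (x : verma lambda) : K := coef x 0 0.
have psiD : {morph psi : x y / x + y} by move=> x y; exact: coefD.
have psiE c a k : psi ((cst c * (pi Q ^+ a * f ^+ k)) *: v) =
    c *+ ((a == 0%N) && (k == 0%N)).
  by have := coef_hw_monomial 0 c a k; rewrite expr0 scale1r.
have [] := @simple_quotient_of_functional _ (verma lambda) K psi (verma_vector lambda).
- exact: psiD.
- by rewrite /psi [coef _]verma_coef_vector // oner_eq0.
- exact: verma_cyclic.
- move=> m psim; have [u mE] := verma_cyclic m.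
  have [t tE] : exists t, (t * pi u) *: v = v.
    by apply: (hw_retract W quot_verma_hw psiD psiE); rewrite quot_vermaZ -mE.
  (* The retraction found in [U_lambda] is lifted to [U]. *)
  have [w tw] := pi_surj t; exists w => a.
  suff -> : w *: m = verma_vector lambda by [].
  by rewrite -[RHS]tE tw -scalerA !quot_vermaZ mE.
by move=> N simN _; exists N.
Qed.

Local Notation L := (L_lambda lambda).

Lemma L_lambda_simple : simple_module L.
Proof. exact/descent_simple/simple_quotient_simple/verma_simple_quotient. Qed.

Definition verma_proj (x : V) : L :=
  quot_mod_pi (simple_quotient_kernel (verma lambda)) x.

Lemma verma_projZ a x : verma_proj (a *: x) = a *: verma_proj x.
Proof.
have [u ->] := pi_surj a.
by rewrite quot_vermaZ /verma_proj linearZ /= [RHS]descentZ.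
Qed.

Lemma verma_proj0 : verma_proj 0 = 0.
Proof. exact: linear0. Qed.

Lemma L_lambda_hw : highest_weight ev e (pi P) (verma_proj v) mu.
Proof.
have [ev0 pv0 hv] := quot_verma_hw.
by split; rewrite -!verma_projZ ?ev0 ?pv0 ?hv ?verma_proj0 // verma_projZ.
Qed.

Lemma verma_proj_neq0 : verma_proj v != 0.
Proof.
apply/eqP => v0; have [[m /eqP m0] _] := L_lambda_simple; apply: m0.
have [x ->] : exists x : V, m = verma_proj x.
  exact: (@quot_mod_pi_surj _ _ (simple_quotient_kernel (verma lambda)) m).
have [u ->] := verma_cyclic x.
by rewrite -quot_vermaZ verma_projZ v0 scaler0.
Qed.

Lemma ideal_of_twoSided (I : twoSidedIdeal A) : ideal (fun x : A => x \in I).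
Proof.
split; [exact: rpred0|by move=> x y Ix Iy; exact: rpredD| |].
- by move=> a x; exact: Defs.idealMl.
- by move=> a x; exact: Defs.idealMr.
Qed.

Lemma U_lambda_simple : (forall k, mu != k%:R) -> (forall k, mu != - k.+2%:R) ->
  simple_algebra A.
Proof.
move=> mu1 mu2; split=> [|I]; first exact: pi1_neq0.
have idI := ideal_of_twoSided I.
have [I0|] := pselect (exists2 x : A, x \in I & x != 0); last first.
  move=> I0; left=> x; rewrite inE; apply/idP/eqP => [Ix|->]; last exact: rpred0.
  by apply: contrapT => /eqP x0; apply: I0; exists x.
right=> x; rewrite inE -[x]mulr1; apply: Defs.idealMl.
exact: (ideal_eqT W idI I0 mu1 mu2).
Qed.

(** * Primitive ideals when [mu] is a natural number *)

Section Integral.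
Variable n : nat.
Hypothesis mun : mu = n%:R.

Lemma singular_hw : highest_weight ev e (pi P) (f ^+ n.+1 *: v) (- (mu + 2)).
Proof. exact: (hw_singular W mun quot_verma_hw). Qed.

(** The element acts on the singular vector by the value of [weight_poly] at [- (mu + 2)], which is
    nonzero, and the coefficient of that vector at [(0, n.+1)] is 1. *)
Lemma quot_weight_poly_neq0 : ev (weight_poly K n) != 0.
Proof.
apply/eqP => R0; have := ev_eigen W (weight_poly K n) (hw_h singular_hw).
rewrite R0 scale0r => H1.
have := coef_hw_monomial n.+1 (weight_poly K n).[- (mu + 2)] 0 0.
rewrite !expr0 !mulr1 -H1 /= => /esym.
have := coefD 0 0 0 n.+1; rewrite addr0 => /eqP.
rewrite -subr_eq0 opprD addNKr oppr_eq0 => /eqP -> /eqP R0'.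
have /root_weight_poly[i lein] : root (weight_poly K n) (- (mu + 2)) by [].
by rewrite mun -weightn_last => /weightn_inj ni; rewrite -ni ltnn in lein.
Qed.

Lemma annihilator_L_lambda_weight_poly : ev (weight_poly K n) \in annihilator L.
Proof.
apply/asboolP => m.
exact: (simple_hw_killed W L_lambda_simple verma_proj_neq0 mun L_lambda_hw).
Qed.

Lemma annihilator_simple (M : lmodType A) : simple_module M ->
  ~ (forall m : M, (1 : A) *: m = 0).
Proof. by move=> [[m m0] _] /(_ m); rewrite scale1r; apply/eqP. Qed.

(** Annihilators of simple modules are proper, and two nonzero proper ideals contain each other. The
    zero ideal arises from the singular vector through [faithful_simple_module]. *)
Lemma U_lambda_primitive (I : {pred A}) :
  primitive_ideal I <-> I =i pred1 0 \/ I =i annihilator L.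
Proof.
split=> [[M simM IE]|[I0|IE]]; last by exists L; first exact: L_lambda_simple.
- have [|] := pselect (exists2 x : A, forall m : M, x *: m = 0 & x != 0); last first.
    move=> I0; left=> x; rewrite IE inE; apply/asboolP/eqP => [Ix|->].
      by apply: contrapT => /eqP x0; apply: I0; exists x.
    by move=> m; rewrite scale0r.
  have J0 : exists2 x : A, forall m : L, x *: m = 0 & x != 0.
    exists (ev (weight_poly K n)); last exact: quot_weight_poly_neq0.
    exact/asboolP/annihilator_L_lambda_weight_poly.
  have idI := annihilator_ideal M; have idJ := annihilator_ideal L.
  have incl := ideal_nontrivial_incl W mun.
  move=> I0; right=> x; rewrite IE; apply/asboolP/asboolP => [xM|xL].
    exact: (incl _ _ idI idJ I0 J0 (annihilator_simple simM) x xM).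
  exact: (incl _ _ idJ idI J0 I0 (annihilator_simple L_lambda_simple) x xL).
pose phi (x : V) : K := coef x 0 n.+1.
have phiD : {morph phi : x y / x + y} by move=> x y; exact: coefD.
have [M simM MA] :=
  faithful_simple_module W mun singular_hw phiD (coef_hw_monomial n.+1).
exists M => // x; rewrite I0 inE; apply/eqP/asboolP => [-> m|/MA //].
exact: scale0r.
Qed.

End Integral.

End PrimitiveIdeals.

Theorem theorem29 (R : realType)
    (lambda : {scalar subvs_of (cartan (R[i])%C)}) :
  lambda (zC (R[i])%C) != 0 ->
  (~ (exists k : int, lambda (hC (R[i])%C) = 1 / 2 + k%:~R) \/
     lambda (hC (R[i])%C) = - (3 / 2) ->
   simple_algebra (U_lambda lambda)) /\
  ((exists n : nat, lambda (hC (R[i])%C) = - (1 / 2) + n%:R) ->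
   ~ ((pred1 0 : {pred U_lambda lambda}) =i annihilator (L_lambda lambda)) /\
   forall I : {pred U_lambda lambda},
     primitive_ideal I <->
     I =i pred1 0 \/ I =i annihilator (L_lambda lambda)).
Proof.
move=> zeta0; set l := lambda (hC _); split=> [hl|[n ln]].
  (* An integral [mu] puts [lambda(h)] in [1/2 + Z], and [lambda(h) = - 3/2] is [mu = -1]; so under
     the hypothesis of (i) no integer other than -1 can be [mu]. *)
  have notn (j : int) : ~ (exists k : int, l = 1 / 2 + k%:~R) \/ l = - (3 / 2) ->
      j != - 1 -> l + 1 / 2 != j%:~R.
    move=> hl' j1; apply/eqP => lj.
    have lE : l = 1 / 2 + (j - 1)%:~R.
      by rewrite rmorphB /= -lj; field.
    case: hl' => [|l32]; first by apply; exists (j - 1).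
    case/eqP: j1; apply/eqP; rewrite -(eqr_int R[i]%C) -lj l32; apply/eqP.
    by rewrite rmorphN /=; field.
  apply: U_lambda_simple => // k.
    exact: (notn (Posz k)).
  by have := notn (Negz k.+1) hl; rewrite NegzE rmorphN /=; apply.
have mun : l + 1 / 2 = n%:R by rewrite ln; field.
split; last by move=> I; apply: (@U_lambda_primitive (R[i])%C lambda zeta0 n mun).
(* The two ideals are told apart by [weight_poly] evaluated at [h], which is nonzero and kills
   [L_lambda]. *)
move=> /(_ (quot_ev lambda (weight_poly _ n))).
rewrite (annihilator_L_lambda_weight_poly zeta0 mun) inE.
by rewrite (negPf (quot_weight_poly_neq0 zeta0 mun)).
Qed.
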